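(* Let $k\ge1$ and $n_1,\ldots,n_k\ge1$. A subspace $\mathcal M\subseteq\bigotimes_{i=1}^kF^2(H_{n_i})$ is invariant under the universal model $\mathbf S$ and has positive defect operator $\Delta_{\mathcal M}$ if and only if there is a sequence $\{\psi_s\}_{s=1}^N$, where $N\in\mathbb N$ or $N=\infty$, of right multipliers of $\bigotimes_{i=1}^kF^2(H_{n_i})$ such that $\{\widetilde\psi_s(\mathbf R_{i,j})\}_{s=1}^N$ are isometries with orthogonal ranges and $$P_{\mathcal M}=\sum_{s=1}^N\widetilde\psi_s(\mathbf R_{i,j})\widetilde\psi_s(\mathbf R_{i,j})^*,$$ where the convergence is in the strong operator topology. The sequence $\{\psi_s\}_{s=1}^N$ is uniquely determined up to a unitary equivalence. In addition, the sequence $\{\psi_s\}_{s=1}^N$ can be chosen such that each $\psi_s$ is in the range of $\Delta_{\mathcal M}$. One also has $N=\mathrm{rank}(\Delta_{\mathcal M}^{1/2})$ and $$\Delta_{\mathcal M}\xi=\sum_{s=1}^N\langle\xi,\psi_s\rangle\psi_s,\qquad\xi\in\bigotimes_{i=1}^kF^2(H_{n_i}).$$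
   Context: $H_{n_i}$ is an $n_i$-dimensional complex Hilbert space with orthonormal basis $e^i_1,\ldots,e^i_{n_i}$, and $F^2(H_{n_i}):=\mathbb C1\oplus\bigoplus_{p\ge1}H_{n_i}^{\otimes p}$ is its full Fock space. $\mathbb F_{n_i}^+$ is the unital free semigroup on generators $g^i_1,\ldots,g^i_{n_i}$ with identity $g^i_0$; the vectors $e^i_\alpha:=e^i_{j_1}\otimes\cdots\otimes e^i_{j_p}$ for $\alpha=g^i_{j_1}\cdots g^i_{j_p}$, together with $e^i_{g_0^i}:=1$, form an orthonormal basis of $F^2(H_{n_i})$. Left and right creation operators on $F^2(H_{n_i})$: $S_{i,j}e^i_\alpha:=e^i_{g^i_j\alpha}$, $R_{i,j}e^i_\alpha:=e^i_{\alpha g^i_j}$. $\mathbf S_{i,j}$ and $\mathbf R_{i,j}$ are the operators on $\bigotimes_{i=1}^kF^2(H_{n_i})$ acting as $S_{i,j}$, respectively $R_{i,j}$, on the $i$-th factor and as the identity on the others. $\mathbf S=(\mathbf S_1,\ldots,\mathbf S_k)$, $\mathbf S_i=(\mathbf S_{i,1},\ldots,\mathbf S_{i,n_i})$, is the universal model. Subspaces are closed; $\mathcal M$ is invariant under $\mathbf S$ if it is invariant under every $\mathbf S_{i,j}$. $\Phi_{\mathbf S_i}(Y):=\sum_{j=1}^{n_i}\mathbf S_{i,j}Y\mathbf S_{i,j}^*$. The defect operator of $\mathcal M$ is $\Delta_{\mathcal M}:=(id-\Phi_{\mathbf S_1})\circ\cdots\circ(id-\Phi_{\mathbf S_k})(P_{\mathcal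 M})$, with $P_{\mathcal M}$ the orthogonal projection onto $\mathcal M$; positive means $\Delta_{\mathcal M}\ge0$. Two invariant subspaces $\mathcal M$ and $\mathcal N$ under $\mathbf S$ are called unitarily equivalent if there is a unitary operator $U:\mathcal M\to\mathcal N$ with $U\mathbf S_{i,j}|_{\mathcal M}=\mathbf S_{i,j}|_{\mathcal N}U$ for all $i,j$; no separate formal definition of unitary equivalence for sequences $\{\psi_s\}$ is given. For $\alpha=g^i_{j_1}\cdots g^i_{j_p}$, $\mathbf R_{i,\alpha}:=\mathbf R_{i,j_1}\cdots\mathbf R_{i,j_p}$ (with $\mathbf R_{i,g^i_0}:=I$), and $\widetilde\alpha:=g^i_{j_p}\cdots g^i_{j_1}$ is the reversed word. For $\varphi=\sum c_{\beta_1,\ldots,\beta_k}e^1_{\beta_1}\otimes\cdots\otimes e^k_{\beta_k}\in\bigotimes_{i=1}^kF^2(H_{n_i})$ and a polynomial $p$ (finite linear combination of vectors $e^1_{\alpha_1}\otimes\cdots\otimes e^k_{\alpha_k}$) put $\widetilde\varphi(\mathbf R_{i,j})p:=\sum c_{\beta_1,\ldots,\beta_k}\mathbf R_{1,\widetilde\beta_1}\cdots\mathbf R_{k,\widetilde\beta_k}p\in\bigotimes_{i=1}^kF^2(H_{n_i})$. $\varphi$ is a right multiplier if $\sup\|\widetilde\varphi(\mathbf R_{i,j})p\|<\infty$ over polynomials $p$ with $\|p\|\le1$; then $\widetilde\varphi(\mathbf R_{i,j})$ also denotes the unique bounded extension to $\bigotimes_{i=1}^kF^2(H_{n_i})$.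 *)

(* Defs.v *)
From HB Require Import structures.
From mathcomp Require Import all_boot all_order all_algebra.
From mathcomp Require Import finmap.
From mathcomp Require Import complex.
From mathcomp Require Import all_classical all_reals all_analysis.
From mathcomp.analysis.showcase Require summability.

Set Implicit Arguments.
Unset Strict Implicit.
Unset Printing Implicit Defensive.

Import Order.TTheory GRing.Theory Num.Theory.
Import numFieldNormedType.Exports.

Local Open Scope classical_set_scope.
Local Open Scope complex_scope.
Local Open Scope ring_scope.

(* Inner products are linear in the first argument and conjugate-linear in
   the second one. *)
HB.mixin Record NormedModule_isHilbert (R : realType) (H : Type)
    of CompleteNormedModule R[i] H := {
  inner : {dot H for @Num.conj R[i]};
  sqr_norm_inner : forall x : H, `|x| ^+ 2 = inner x x
}.

#[short(type="hilbertType")]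
HB.structure Definition Hilbert (R : realType) :=
  {H of CompleteNormedModule R[i] H & NormedModule_isHilbert R H}.

Section Hilbert_spaces.
Variable R : realType.
Implicit Types H G : hilbertType R.

Definition lspan H (A : set H) : set H :=
  [set x | exists s : seq (R[i] * H),
     (forall p, p \in s -> A p.2) /\ x = \sum_(p <- s) p.1 *: p.2].

Definition closed_subspace H (M : set H) : Prop :=
  [/\ closed M, M 0 & forall (a : R[i]) x y, M x -> M y -> M (a *: x + y)].

Definition orthonormal_basis H (I : eqType) (J : set I) (f : I -> H)
    (V : set H) : Prop :=
  (forall i j, J i -> J j -> inner (f i) (f j) = (i == j)%:R) /\
  closure (lspan (f @` J)) = V.

Definition bounded_op H G (A : H -> G) : Prop := linear A /\ continuous A.

(* The junk value of xget, here and below, is never used where the object with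
   the required property exists and is unique. *)
Definition bounded_op_such_that H G (P : (H -> G) -> Prop) : H -> G :=
  xget (fun=> 0) [set A | bounded_op A /\ P A].

Definition adjoint H G (A : H -> G) : G -> H :=
  fun y => xget 0 [set z | forall x, inner (A x) y = inner x z].

Definition orth_proj H (M : set H) : H -> H :=
  fun x => xget 0 [set y | M y /\ forall m, M m -> inner (x - y) m = 0].

Definition isometric H G (A : H -> G) : Prop := forall x, `|A x| = `|x|.

(* The order of R[i] is the partial one: 0 <= z means that z is real and
   nonnegative. *)
Definition positive_op H (A : H -> H) : Prop := forall x, 0 <= inner (A x) x.

Definition sqrt_op H (A : H -> H) : H -> H :=
  bounded_op_such_that (fun B => positive_op B /\ B \o B = A).

(* The lengths N of sequences range over the naturals (Some m) and oo (None);
   sequences {psi_s}, 1 <= s <= N, are indexed from 0. *)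
Definition lt_len (s : nat) (N : option nat) : bool :=
  if N is Some m then (s < m)%N else true.

(* The Hilbert dimension of the closure of the range is N. *)
Definition has_rank H (A : H -> H) (N : option nat) : Prop :=
  exists f : nat -> H,
    orthonormal_basis [set s | lt_len s N] f (closure (range A)).

(* The sum over s < N of v_s is x. *)
Definition sums_to (V : normedModType R[i]) (N : option nat) (v : nat -> V)
    (x : V) : Prop :=
  (fun m => \sum_(0 <= s < m | lt_len s N) v s) @ \oo --> x.

(* U = [u_st] is a unitary operator on l^2({s | s < N}): its rows and its
   columns are orthonormal. *)
Definition unitary_matrix (N : option nat) (u : nat -> nat -> R[i]) : Prop :=
  (forall s t, lt_len s N -> lt_len t N ->
     sums_to (V := R[i]^o) N (fun r => u s r * (u t r)^*) (s == t)%:R) /\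
  (forall s t, lt_len s N -> lt_len t N ->
     sums_to (V := R[i]^o) N (fun r => u r s * (u r t)^*) (s == t)%:R).

Definition unitarily_equivalent_seq H (N : option nat) (psi : nat -> H)
    (N' : option nat) (psi' : nat -> H) : Prop :=
  N = N' /\
  exists2 u : nat -> nat -> R[i], unitary_matrix N u &
    forall s, lt_len s N -> sums_to N (fun t => u s t *: psi t) (psi' s).

(* Full Fock space C1 (+) H (+) H^(x)2 (+) ... of H, given by its elementary
   tensors: fock_pure [:: x1; ...; xp] is x1 (x) ... (x) xp in the p-fold tensor
   power of H, and fock_pure [::] is the vacuum vector 1.  Tensor powers of
   different orders are orthogonal.  The inner products of the elementary
   tensors and their totality determine the space up to a unique unitary (and
   force multilinearity). *)
Record fock_space H := FockSpace {
  fock_sort :> hilbertType R;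
  fock_pure : seq H -> fock_sort;
  fock_pure_inner : forall x y : seq H,
    inner (fock_pure x) (fock_pure y) =
      if size x == size y then \prod_(p <- zip x y) inner p.1 p.2 else 0;
  fock_pure_total : closure (lspan (range fock_pure)) = setT
}.

(* Hilbert space tensor product, given in the same way by its elementary
   tensors. *)
Record hilbert_tensor (k : nat) (F : 'I_k -> hilbertType R) := HilbertTensor {
  tensor_sort :> hilbertType R;
  tensor_pure : (forall i, F i) -> tensor_sort;
  tensor_pure_inner : forall x y : forall i, F i,
    inner (tensor_pure x) (tensor_pure y) = \prod_i inner (x i) (y i);
  tensor_pure_total : closure (lspan (range tensor_pure)) = setT
}.

End Hilbert_spaces.

Arguments fock_pure {R H f}.
Arguments tensor_pure {R k F h}.

Section Universal_model.
Variables (R : realType) (k : nat) (n : 'I_k -> nat).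
Variables (H : 'I_k -> hilbertType R) (e : forall i, 'I_(n i) -> H i).
Variable F : forall i, fock_space (H i).
Variable T : hilbert_tensor (fun i => F i : hilbertType R).

(* The free semigroup on n_i generators is seq 'I_(n i), with concatenation as
   product and [::] as identity. *)
Definition multiword : choiceType := {dffun forall i : 'I_k, seq 'I_(n i)}.

Definition fock_vec i (a : seq 'I_(n i)) : F i := fock_pure (map (@e i) a).

Definition vec (w : multiword) : T := tensor_pure (fun i => fock_vec (w i)).

Definition left_creation i (j : 'I_(n i)) : F i -> F i :=
  bounded_op_such_that (fun A => forall a, A (fock_vec a) = fock_vec (j :: a)).

Definition right_creation i (j : 'I_(n i)) : F i -> F i :=
  bounded_op_such_that (fun A => forall a, A (fock_vec a) = fock_vec (rcons a j)).

(* I (x) ... (x) A (x) ... (x) I with A in the i-th position. *)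
Definition ampliation i (A : F i -> F i) : T -> T :=
  bounded_op_such_that (fun B => forall x : forall i', F i',
    B (tensor_pure x) = tensor_pure (dfwith x i (A (x i)))).

Definition opS i (j : 'I_(n i)) : T -> T := ampliation (left_creation j).
Definition opR i (j : 'I_(n i)) : T -> T := ampliation (right_creation j).

Definition S_invariant (M : set T) : Prop :=
  forall i (j : 'I_(n i)) x, M x -> M (opS j x).

Definition Phi i (Y : T -> T) : T -> T :=
  fun x => \sum_(j < n i) opS j (Y (adjoint (opS j) x)).

Definition defect (M : set T) : T -> T :=
  foldr (fun i Y x => Y x - Phi i Y x) (orth_proj M) (enum 'I_k).

Definition opR_word i (a : seq 'I_(n i)) : T -> T :=
  foldr (fun j B => opR j \o B) id a.

(* R_{1,b_1~} ... R_{k,b_k~} for the reversed words b_i~. *)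
Definition opR_rev (w : multiword) : T -> T :=
  foldr (fun i B => opR_word (rev (w i)) \o B) id (enum 'I_k).

Definition is_polynomial (p : T) : Prop := lspan (range vec) p.

(* The (unconditional) sum over all multiwords of c_w R_{w~} p, where the
   c_w = inner phi e_w are the coefficients of phi. *)
Definition mult_poly (phi p : T) : T :=
  summability.sum (fun w : multiword => inner phi (vec w) *: opR_rev w p).

Definition right_multiplier (phi : T) : Prop :=
  exists C : R[i], forall p, is_polynomial p -> `|p| <= 1 ->
    `|mult_poly phi p| <= C.

Definition mult_op (phi : T) : T -> T :=
  bounded_op_such_that (fun A => forall p, is_polynomial p -> A p = mult_poly phi p).

Definition beurling_sequence (M : set T) (N : option nat) (psi : nat -> T) :
    Prop :=
  [/\ forall s, lt_len s N -> right_multiplier (psi s),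
      forall s, lt_len s N -> isometric (mult_op (psi s)),
      forall s t, lt_len s N -> lt_len t N -> s != t ->
        forall x y, inner (mult_op (psi s) x) (mult_op (psi t) y) = 0
    & forall x,
        sums_to N (fun s => mult_op (psi s) (adjoint (mult_op (psi s)) x))
          (orth_proj M x)].

End Universal_model.

(* Main.v *)
From HB Require Import structures.
Require Import Defs.
From mathcomp Require Import all_boot all_order all_algebra.
From mathcomp Require Import finmap.
From mathcomp Require Import complex.
From mathcomp Require Import all_classical all_reals all_analysis.
From mathcomp.analysis.showcase Require summability.
From mathcomp Require Import ring lra zify.

(** The operators S_w = S_{1,w_1} ... S_{k,w_k} are indexed by multiwords w and
    act on the orthonormal basis by e_v |-> e_{wv}; the k freely generated
    families commute with one another. Let P be the projection onto M and Delta
    its defect operator.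

    Positivity gives isometries. Each equation Y = (id - Phi_i)(Y) + Phi_i(Y)
    can be iterated along the i-th word of a basis vector until that word is
    used up ([telescope]). Hence P is the sum of the operators S_w Delta S_w^*,
    with finitely many nonzero terms on each basis vector. If Delta >= 0, the
    forms <Delta S_w^* x, S_w^* x> are nonnegative and add up to |P x|^2 for all
    x ([defect_form_sum_le], [defect_form_sum_approx]). Everything follows by
    comparing a few terms of this series of nonnegative numbers with its sum: at
    x = S_g y with y in M, the words starting with the generator g exhaust
    the sum, so that Delta S_g P = 0 ([defect_left_gen]); at x = Delta y only
    the empty word is left, so that Delta is a projection ([wandering_idem]); at
    x = S_v psi with psi in the range of Delta, the word v exhausts the sum, so
    that S_v psi is orthogonal to S_w psi' for w <> v, for psi' also in that
    range ([wandering_orthogonal]). For an orthonormal basis psi_s of the range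
    of Delta the vectors S_w psi_s are therefore orthonormal, and they are total
    in M ([defect_separates]). The multiplier of symbol psi_s maps e_w to
    S_w psi_s ([mult_polyE]), so these multipliers are isometries with
    orthogonal ranges, whose sum is M ([beurling_exists]).

    Conversely, multipliers A_s as in the theorem commute with all S_w, so that
    M is invariant. The defect operator of A_s A_s^* is A_s Delta(I) A_s^*,
    where Delta(I) is the projection onto the vacuum vector, which A_s maps to
    psi_s. Thus Delta is the sum of the rank one projections <., psi_s> psi_s
    ([defect_sum]); it is positive, and psi is an orthonormal basis of its
    range. This gives the rank, and it gives uniqueness, as two orthonormal
    bases of the same space differ by a unitary matrix ([beurling_unique]).

    The Fock spaces and their tensor product are known only through the inner
    products of elementary tensors. That the vectors e_w form an orthonormal
    basis, and that the creation operators act on it as expected, is derived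
    from these inner products ([vec_total], [ampliation_shift]). *)

Set Implicit Arguments.
Unset Strict Implicit.
Unset Printing Implicit Defensive.
Import Order.TTheory GRing.Theory Num.Theory.
Import numFieldNormedType.Exports.
Local Open Scope classical_set_scope.
Local Open Scope complex_scope.
Local Open Scope ring_scope.

(** * Norms and limits with real estimates *)

Section Norm.
Variable R : realType.
Local Notation C := R[i].

(** The norm of a space over R[i] takes its values in R[i], whose order is
    only partial; estimates and suprema need it as an element of R. *)
Definition rnorm (V : normedZmodType C) (x : V) : R := complex.Re `|x|.

Lemma rnormE (V : normedZmodType C) (x : V) : `|x| = (rnorm x)%:C.
Proof.
have := normr_ge0 x; rewrite /rnorm; case: (`|x|) => a b.
by rewrite lecE /= => /andP[/eqP -> _].
Qed.

Lemma rcD (a b : R) : ((a + b)%:C : C) = a%:C + b%:C. Proof. exact: rmorphD. Qed.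
Lemma rcB (a b : R) : ((a - b)%:C : C) = a%:C - b%:C. Proof. exact: rmorphB. Qed.
Lemma rc1 : (1%:C : C) = 1. Proof. by []. Qed.
Lemma rcM (a b : R) : ((a * b)%:C : C) = a%:C * b%:C. Proof. exact: rmorphM. Qed.
Lemma rcX (a : R) m : ((a ^+ m)%:C : C) = a%:C ^+ m. Proof. exact: rmorphXn. Qed.
Lemma rc_sum (I : Type) (r : seq I) (P : pred I) (f : I -> R) :
  ((\sum_(i <- r | P i) f i)%:C : C) = \sum_(i <- r | P i) (f i)%:C.
Proof. exact: rmorph_sum. Qed.
Lemma rc_conj (a : R) : (a%:C : C)^* = a%:C.
Proof. by apply/CrealP; rewrite complex_real. Qed.

Lemma gt0_real (e : C) : 0 < e -> e = (complex.Re e)%:C.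
Proof. by case: e => a b; rewrite ltcE /= => /andP[/eqP -> _]. Qed.

Lemma rnorm_ge0 (V : normedZmodType C) (x : V) : 0 <= rnorm x.
Proof. by have := normr_ge0 x; rewrite rnormE lecR. Qed.

Lemma rnorm0 (V : normedZmodType C) : rnorm (0 : V) = 0.
Proof. by rewrite /rnorm normr0. Qed.

Lemma rnorm0_eq (V : normedZmodType C) (x : V) : rnorm x = 0 -> x = 0.
Proof. by move=> h; apply/normr0_eq0; rewrite rnormE h. Qed.

Lemma rnormN (V : normedZmodType C) (x : V) : rnorm (- x) = rnorm x.
Proof. by rewrite /rnorm normrN. Qed.

Lemma rnormBC (V : normedZmodType C) (x y : V) : rnorm (x - y) = rnorm (y - x).
Proof. by rewrite /rnorm distrC. Qed.

Lemma rnormD (V : normedZmodType C) (x y : V) : rnorm (x + y) <= rnorm x + rnorm y.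
Proof. by have := ler_normD x y; rewrite !rnormE -rmorphD lecR. Qed.

Lemma rnormZ (V : normedModType C) (a : C) (x : V) : rnorm (a *: x) = rnorm a * rnorm x.
Proof. by have := normrZ a x; rewrite !rnormE -rmorphM => -[]. Qed.

Lemma rnormM (a b : C) : rnorm (a * b) = rnorm a * rnorm b.
Proof. by have := normrM a b; rewrite !rnormE -rmorphM => -[]. Qed.

Lemma rnormC (a : C) : rnorm a^* = rnorm a.
Proof. by have := norm_conjC a; rewrite !rnormE => -[]. Qed.

Lemma mul_conjE (a : C) : a * a^* = (rnorm a ^+ 2)%:C.
Proof. by rewrite -normCK rnormE rmorphXn. Qed.

Lemma rnorm_realC (a : R) : rnorm (a%:C : C) = `|a|.
Proof. by rewrite /rnorm normc_def /= expr0n addr0 sqrtr_sqr. Qed.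

Lemma le0_of_le_eps (a : R) : (forall e, 0 < e -> a <= e) -> a <= 0.
Proof. by move=> h; rewrite leNgt; apply/negP => a0; have := h (a/2) ; lra. Qed.

Lemma cvg_rnormP (V : normedModType C) (u : nat -> V) (x : V) :
  u @ \oo --> x <->
  forall e : R, 0 < e -> exists N, forall m, (N <= m)%N -> rnorm (x - u m) <= e.
Proof.
split.
  move=> /cvgrPdist_le h e e0.
  have /h : 0 < e%:C by rewrite ltcR.
  case=> N _ hN; exists N => m /hN /=.
  by rewrite rnormE lecR.
move=> h; apply/cvgrPdist_le => e e0.
have e1 := gt0_real e0.
have /h [N hN] : 0 < complex.Re e by rewrite -ltcR -e1.
exists N => // m /= /hN; rewrite -lecR -e1; by rewrite -rnormE.
Qed.

Lemma closure_rnormP (V : normedModType C) (A : set V) x :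
  closure A x <-> forall e : R, 0 < e -> exists2 y, A y & rnorm (x - y) <= e.
Proof.
split=> [h e e0|h B].
  have /h [y [Ay By]] : nbhs x (ball x (e%:C : C)) by apply: nbhsx_ballx; rewrite ltcR.
  exists y => //; move: By; rewrite -ball_normE /= rnormE ltcR; exact: ltW.
move=> /nbhs_ballP [e /= e0].
have e1 := gt0_real e0.
have /h [y Ay xy] : 0 < complex.Re e / 2 by rewrite divr_gt0// -ltcR -e1.
move=> sB; exists y; split => //; apply: sB.
rewrite -ball_normE /= rnormE e1 ltcR; apply: le_lt_trans xy _.
by rewrite ltr_pdivrMr // ltr_pMr ?ltr1n // -ltcR -e1.
Qed.

Lemma lipschitz_continuous (V W : normedModType C) (f : V -> W) (K : R) :
  (forall x y, rnorm (f x - f y) <= K * rnorm (x - y)) -> continuous f.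
Proof.
move=> h x; apply/cvgrPdist_le => e e0.
have e1 := gt0_real e0.
have K0 : 0 < Num.max K 1 by rewrite lt_max ltr01 orbT.
have : 0 < (complex.Re e / Num.max K 1)%:C.
  by rewrite ltcR divr_gt0 // -ltcR -e1.
move=> d0; have := @nbhsx_ballx _ _ x _ d0.
apply: filterS => y; rewrite -ball_normE /= rnormE ltcR => xy.
rewrite rnormE e1 lecR; apply: (le_trans (h _ _)).
apply: (@le_trans _ _ (Num.max K 1 * rnorm (x - y))).
  by apply: ler_wpM2r; rewrite ?rnorm_ge0 // le_max lexx.
by rewrite mulrC -ler_pdivlMr //; exact: ltW.
Qed.

Lemma lipschitz_cvg (V W : normedModType C) (f : V -> W) (K : R) (u : nat -> V) (x : V) :
  (forall x y, rnorm (f x - f y) <= K * rnorm (x - y)) ->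
  u @ \oo --> x -> (fun m => f (u m)) @ \oo --> f x.
Proof.
move=> h /cvg_rnormP hu; apply/cvg_rnormP => e e0.
have K0 : 0 < Num.max K 1 by rewrite lt_max ltr01 orbT.
have [|N hN] := hu (e / Num.max K 1); first by rewrite divr_gt0.
exists N => m /hN xy; apply: (le_trans (h _ _)).
apply: (@le_trans _ _ (Num.max K 1 * rnorm (x - u m))).
  by apply: ler_wpM2r; rewrite ?rnorm_ge0 // le_max lexx.
by rewrite mulrC -ler_pdivlMr.
Qed.

Lemma bounded_opP (V W : normedModType C) (f : V -> W) :
  linear f -> continuous f -> exists2 K : R, 0 < K & forall x, rnorm (f x) <= K * rnorm x.
Proof.
move=> lf cf.
pose g : {linear V -> W} := HB.pack f (GRing.isLinear.Build _ _ _ _ f lf).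
have /linear_boundedP h : bounded_near g (nbhs (0:V)).
  apply: continuous_linear_bounded; exact: cf.
have [r [r0 hr]] : exists r : C, 0 < r /\ (forall x : V, `|g x| <= r * `|x|).
  have [K [Kr hK]] := h.
  exists (Num.max K 0 + 1); split.
    rewrite ltr_wpDl //; first by rewrite comparable_le_max ?lexx ?orbT // real_comparable.
  apply: hK. apply: le_lt_trans (_ : Num.max K 0 < _).
    by rewrite comparable_le_max ?lexx // real_comparable.
  by rewrite ltrDl.
have e1 := gt0_real r0.
exists (complex.Re r); first by rewrite -ltcR -e1.
by move=> x; have := hr x; rewrite e1 !rnormE -rmorphM lecR.
Qed.

Lemma cauchy_rnorm_cvg (V : completeNormedModType C) (u : nat -> V) :
  (forall e : R, 0 < e -> exists N, forall m p, (N <= m)%N -> (N <= p)%N ->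
     rnorm (u m - u p) <= e) -> exists x : V, u @ \oo --> x.
Proof.
move=> h; suff /cauchy_cvgP /cvg_ex [x hx] : cauchy (u @ \oo) by exists x.
apply/cauchy_ballP => e e0.
have e1 := gt0_real e0.
have e2 : 0 < complex.Re e by rewrite -ltcR -e1.
have /h [N hN] : 0 < complex.Re e / 2 by rewrite divr_gt0.
exists ([set x | exists2 m, (N <= m)%N & x = u m], [set x | exists2 m, (N <= m)%N & x = u m]).
  by split; exists N => // m /= Nm; exists m.
move=> [x y] /= [[m Nm ->] [p Np ->]].
rewrite -ball_normE /= rnormE e1 ltcR; apply: le_lt_trans (hN _ _ Nm Np) _.
by rewrite ltr_pdivrMr // ltr_pMr ?ltr1n.
Qed.
End Norm.

(** * Inner products and closed subspaces *)

Section Inner.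
Variable R : realType.
Local Notation C := R[i].
Variable H : hilbertType R.
Implicit Types (x y z : H) (a : C).

Lemma innerDl x y z : inner (x + y) z = inner x z + inner y z.
Proof. exact: linearDl. Qed.
Lemma innerDr x y z : inner z (x + y) = inner z x + inner z y.
Proof. exact: linearDr. Qed.
Lemma innerBl x y z : inner (x - y) z = inner x z - inner y z.
Proof. exact: linearBl. Qed.
Lemma innerBr x y z : inner z (x - y) = inner z x - inner z y.
Proof. exact: linearBr. Qed.
Lemma inner0l z : inner (0 : H) z = 0.
Proof. exact: linear0l. Qed.
Lemma inner0r z : inner z (0 : H) = 0.
Proof. exact: linear0r. Qed.
Lemma innerZl a x y : inner (a *: x) y = a * inner x y.
Proof. exact: linearZl_LR. Qed.
Lemma innerZr a x y : inner x (a *: y) = a^* * inner x y.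
Proof. exact: linearZr_LR. Qed.
Lemma inner_suml (I : Type) (r : seq I) (P : pred I) (f : I -> H) y :
  inner (\sum_(i <- r | P i) f i) y = \sum_(i <- r | P i) inner (f i) y.
Proof. exact: linear_sumlz. Qed.
Lemma inner_sumr (I : Type) (r : seq I) (P : pred I) (f : I -> H) y :
  inner y (\sum_(i <- r | P i) f i) = \sum_(i <- r | P i) inner y (f i).
Proof. exact: linear_sumr. Qed.
Lemma innerC x y : inner x y = (inner y x)^*.
Proof. by have := hermC (@inner R H) x y; rewrite expr0 mul1r. Qed.
Lemma inner_eq0C x y : inner x y = 0 -> inner y x = 0.
Proof. by move=> h; rewrite innerC h rmorph0. Qed.

Lemma innerxx x : inner x x = (rnorm x ^+ 2)%:C.
Proof. by rewrite -sqr_norm_inner rnormE rmorphXn. Qed.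

Lemma inner_self0 x : inner x x = 0 -> x = 0.
Proof.
rewrite innerxx => -[] /eqP; rewrite sqrf_eq0 => /eqP; exact: rnorm0_eq.
Qed.

Lemma pythagoras x y : inner x y = 0 -> rnorm (x + y) ^+ 2 = rnorm x ^+ 2 + rnorm y ^+ 2.
Proof.
move=> h; have := innerxx (x + y).
by rewrite innerDl !innerDr h (inner_eq0C h) addr0 add0r !innerxx -rmorphD => -[].
Qed.

Lemma parallelogram x y :
  rnorm (x + y) ^+ 2 + rnorm (x - y) ^+ 2 =
  (rnorm x ^+ 2 + rnorm y ^+ 2) + (rnorm x ^+ 2 + rnorm y ^+ 2).
Proof.
suff : ((rnorm (x + y) ^+ 2 + rnorm (x - y) ^+ 2)%:C : C) = 
  (rnorm x ^+ 2 + rnorm y ^+ 2 + (rnorm x ^+ 2 + rnorm y ^+ 2))%:C by case.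
rewrite !rcD -!innerxx innerBl !innerDl !innerBr !innerDr.
ring.
Qed.

Lemma cauchy_schwarz x y : rnorm (inner x y) <= rnorm x * rnorm y.
Proof.
have [->|y0] := eqVneq y 0; first by rewrite inner0r !rnorm0 mulr0.
have hy : 0 < rnorm y.
  by rewrite lt_neqAle rnorm_ge0 andbT eq_sym; apply: contraNneq y0 => /rnorm0_eq ->.
set a := inner x y; pose b := (rnorm y ^+ 2)%:C : C.
(* the projection of x onto the orthogonal complement of y, times |y|^2 *)
have : inner (b *: x - a *: y) (b *: x - a *: y) =
   (rnorm y ^+ 2 * (rnorm y ^+ 2 * rnorm x ^+ 2 - rnorm a ^+ 2))%:C.
  rewrite innerBl !innerBr !innerZl !innerZr !innerxx -/a.
  have -> : inner y x = a^* by rewrite innerC.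
  have -> : b^* = b by exact: rc_conj.
  rewrite rcM rcB rcM -mul_conjE -/b; ring.
rewrite innerxx => -[] e.
have h2 : rnorm a ^+ 2 <= (rnorm x * rnorm y) ^+ 2.
  rewrite exprMn mulrC -subr_ge0 -(pmulr_rge0 _ (exprn_gt0 2 hy)) -e.
  exact: exprn_ge0 (rnorm_ge0 _).
by rewrite -(ler_pXn2r (ltn0Sn 1)) // nnegrE ?mulr_ge0 ?rnorm_ge0.
Qed.

Lemma inner_cvgl (u : nat -> H) x y :
  u @ \oo --> x -> (fun m => inner (u m) y : C^o) @ \oo --> (inner x y : C^o).
Proof.
apply: (@lipschitz_cvg _ _ _ (fun x => inner x y : C^o) (rnorm y)) => a b.
by rewrite -innerBl mulrC; exact: cauchy_schwarz.
Qed.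

Lemma cvg_nat_unique (V : normedModType C) (u : nat -> V) (x y : V) :
  u @ \oo --> x -> u @ \oo --> y -> x = y.
Proof. by move=> hx hy; apply: (cvg_unique _ hx hy). Qed.

Lemma cvg_inner_eq (u : nat -> H) x y (a : C) :
  u @ \oo --> x -> (exists N, forall m, (N <= m)%N -> inner (u m) y = a) -> inner x y = a.
Proof.
move=> /(@inner_cvgl _ _ y) h [N hN]; apply: (cvg_nat_unique h).
apply/cvg_rnormP => e e0; exists N => m /hN ->; rewrite subrr rnorm0; exact: ltW.
Qed.

Lemma cvg_nat_sum (V : normedModType C) (I : Type) (r : seq I) (u : I -> nat -> V) (x : I ->
  V) :
  (forall i, u i @ \oo --> x i) ->
  (fun m => \sum_(i <- r) u i m) @ \oo --> \sum_(i <- r) x i.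
Proof.
move=> h; elim: r => [|i r IH].
  by under eq_fun do rewrite big_nil; rewrite big_nil; exact: cvg_cst.
under eq_fun do rewrite big_cons.
by rewrite big_cons; apply: cvgD.
Qed.

Lemma subspace0 (M : set H) : closed_subspace M -> M 0.
Proof. by case. Qed.
Lemma subspaceZ (M : set H) a x : closed_subspace M -> M x -> M (a *: x).
Proof. by move=> [_ h0 h] Mx; rewrite -[_ *: _]addr0; exact: h. Qed.
Lemma subspaceD (M : set H) x y : closed_subspace M -> M x -> M y -> M (x + y).
Proof. by move=> [_ h0 h] Mx My; rewrite -[x]scale1r; exact: h. Qed.
Lemma subspaceB (M : set H) x y : closed_subspace M -> M x -> M y -> M (x - y).
Proof. by move=> hM Mx My; apply: subspaceD => //; rewrite -scaleN1r; exact: subspaceZ. Qed.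
Lemma subspace_sum (M : set H) (I : eqType) (r : seq I) (P : pred I) (f : I -> H) :
  closed_subspace M -> (forall i, i \in r -> P i -> M (f i)) -> M (\sum_(i <- r | P i) f i).
Proof.
move=> hM hf; rewrite big_seq_cond.
apply: (big_ind M) => [|x y|i /andP[]]; [exact: subspace0|exact: subspaceD|exact: hf].
Qed.
Lemma subspace_cvg (M : set H) (u : nat -> H) x :
  closed_subspace M -> (forall m, M (u m)) -> u @ \oo --> x -> M x.
Proof. by move=> [cM _ _] hu; apply: closed_cvg => //; exact: nearW. Qed.

Lemma lspan_in (A : set H) x : A x -> lspan A x.
Proof.
move=> Ax; exists [:: (1, x)]; split=> [p|]; first by rewrite inE => /eqP ->.
by rewrite big_seq1 scale1r.
Qed.

Lemma lspanZD (A : set H) a x y : lspan A x -> lspan A y -> lspan A (a *: x + y).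
Proof.
move=> [s [hs ->]] [t [ht ->]]; exists ([seq (a * p.1, p.2) | p <- s] ++ t); split.
  move=> p; rewrite mem_cat => /orP[/mapP[q /hs qs -> //]|]; exact: ht.
rewrite big_cat big_map scaler_sumr; congr (_ + _).
by apply: eq_bigr => p _; rewrite scalerA.
Qed.

Lemma subspace_closure_lspan (A : set H) : closed_subspace (closure (lspan A)).
Proof.
split; first exact: closed_closure.
  apply: subset_closure; exists [::]; by split=> //; rewrite big_nil.
move=> a x y /closure_rnormP hx /closure_rnormP hy; apply/closure_rnormP => e e0.
have K0 : 0 < rnorm a + 1 by rewrite ltr_wpDl ?rnorm_ge0.
have [|x' Ax' hx'] := hx (e / 2 / (rnorm a + 1)); first by rewrite !divr_gt0.
have [|y' Ay' hy'] := hy (e / 2); first by rewrite !divr_gt0.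
exists (a *: x' + y'); first exact: lspanZD.
rewrite opprD addrACA -scalerBr; apply: (le_trans (rnormD _ _)).
rewrite [leRHS](splitr e); apply: lerD => //.
rewrite rnormZ; apply: (@le_trans _ _ ((rnorm a + 1) * rnorm (x - x'))).
  by apply: ler_wpM2r; rewrite ?rnorm_ge0 // lerDl.
by rewrite mulrC -ler_pdivlMr.
Qed.

Lemma closure_lspan_min (A V : set H) :
  closed_subspace V -> A `<=` V -> closure (lspan A) `<=` V.
Proof.
move=> hV AV; have [cV _ _] := hV; rewrite [X in _ `<=` X](_ : V = closure V); last by apply/closure_id.
apply: closure_subset => x [s [hs ->]].
by apply: subspace_sum => // p ps _; apply: subspaceZ => //; apply/AV/hs.
Qed.

(** A property which defines a closed subspace holds everywhere as soon as it
    holds on a total set. All identities between bounded operators are reduced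
    to basis vectors in this way. *)
Lemma total_ind (A V : set H) :
  closure (lspan A) = setT -> closed_subspace V -> A `<=` V -> forall x, V x.
Proof. by move=> hA hV AV x; apply: (closure_lspan_min hV AV); rewrite hA. Qed.

Lemma subspace_lipschitz_ker (V : normedModType C) (phi : H -> V) (K : R) :
  linear phi -> (forall x, rnorm (phi x) <= K * rnorm x) ->
  closed_subspace [set x | phi x = 0].
Proof.
move=> lin hK.
have phi0 : phi 0 = 0.
  by have := lin (-1) 0 0; rewrite scaler0 add0r scaleN1r addNr.
split=> //=; last first.
  by move=> a x y ex ey; rewrite lin ex ey scaler0 addr0.
rewrite closure_id; apply/seteqP; split; first exact: subset_closure.
move=> x /closure_rnormP hx; apply/rnorm0_eq/eqP; rewrite eq_le rnorm_ge0 andbT.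
have K0 : 0 < Num.max K 1 by rewrite lt_max ltr01 orbT.
apply: le0_of_le_eps => e e0; have [|y /= Ay xy] := hx (e / Num.max K 1); first by rewrite divr_gt0.
have -> : phi x = phi (x - y).
  by rewrite -[x - y]addrC -scaleN1r lin Ay scaler0 add0r.
apply: (le_trans (hK _)); apply: (@le_trans _ _ (Num.max K 1 * rnorm (x - y))).
  by apply: ler_wpM2r; rewrite ?rnorm_ge0 // le_max lexx.
by rewrite mulrC -ler_pdivlMr.
Qed.

Lemma subspace_orth y : closed_subspace [set x | inner x y = 0].
Proof.
apply: (@subspace_lipschitz_ker C^o (fun x => inner x y) (rnorm y)) => [a u v|u].
  by rewrite innerDl innerZl.
by rewrite mulrC; exact: cauchy_schwarz.
Qed.

Lemma total_orth0 (A : set H) y :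
  closure (lspan A) = setT -> (forall x, A x -> inner x y = 0) -> y = 0.
Proof.
move=> hA h; apply: inner_self0.
exact: (total_ind hA (subspace_orth y)).
Qed.
End Inner.

(** * Bounded operators *)

Section Ops.
Variable R : realType.
Local Notation C := R[i].
Implicit Types H G K : hilbertType R.

Lemma linD H G (A : H -> G) : linear A -> forall x y, A (x + y) = A x + A y.
Proof. by move=> h x y; have := h 1 x y; rewrite !scale1r. Qed.

Lemma lin0 H G (A : H -> G) : linear A -> A 0 = 0.
Proof. by move=> /linD h; apply: (addrI (A 0)); rewrite -h !addr0. Qed.

Lemma linZ H G (A : H -> G) : linear A -> forall a x, A (a *: x) = a *: A x.
Proof. by move=> h a x; have := h a x 0; rewrite !addr0 (lin0 h) addr0. Qed.

Lemma linB H G (A : H -> G) : linear A -> forall x y, A (x - y) = A x - A y.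
Proof. by move=> h x y; rewrite (linD h) -scaleN1r (linZ h) scaleN1r. Qed.

Lemma linear_bigsum H G (A : H -> G) : linear A ->
  forall (I : Type) (r : seq I) (P : pred I) (f : I -> H),
  A (\sum_(i <- r | P i) f i) = \sum_(i <- r | P i) A (f i).
Proof.
by move=> h I r P f; apply: big_morph; [exact: linD|exact: lin0].
Qed.

Lemma op_cvg H G (A : H -> G) (u : nat -> H) x :
  bounded_op A -> u @ \oo --> x -> (A \o u) @ \oo --> A x.
Proof. move=> [lA cA]; have [K K0 hK] := bounded_opP lA cA.
by apply: (@lipschitz_cvg _ _ _ A K) => a b; rewrite -(linB lA). Qed.

Lemma bounded_opI H G (A : H -> G) (K : R) :
  linear A -> (forall x, rnorm (A x) <= K * rnorm x) -> bounded_op A.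
Proof.
move=> lA h; split=> //; apply: (@lipschitz_continuous _ _ _ _ K) => x y.
by rewrite -(linB lA); exact: h.
Qed.

Lemma bounded_op_such_thatP H G (P : (H -> G) -> Prop) :
  (exists A, bounded_op A /\ P A) ->
  bounded_op (bounded_op_such_that P) /\ P (bounded_op_such_that P).
Proof. by case=> A hA; rewrite /bounded_op_such_that; case: xgetP => [B _ //|/(_ A)]. Qed.

Lemma comp_bounded H G K (A : G -> K) (B : H -> G) :
  bounded_op A -> bounded_op B -> bounded_op (A \o B).
Proof.
move=> [lA cA] [lB cB]; split=> [a x y|x] /=; first by rewrite lB lA.
by apply: continuous_comp; [exact: cB|exact: cA].
Qed.

Lemma id_bounded H : bounded_op (@id H).
Proof. by split=> [//|x]; exact: cvg_id. Qed.

Lemma add_bounded H G (A B : H -> G) :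
  bounded_op A -> bounded_op B -> bounded_op (fun x => A x + B x).
Proof.
move=> [lA cA] [lB cB]; split=> [a x y|x].
  by rewrite lA lB scalerDr addrACA.
by apply: continuousD; [exact: cA|exact: cB].
Qed.

Lemma scale_bounded H G (A : H -> G) (c : C) :
  bounded_op A -> bounded_op (fun x => c *: A x).
Proof.
move=> [lA cA]; have [K K0 hK] := bounded_opP lA cA.
apply: (@bounded_opI _ _ _ (rnorm c * K)) => [a x y|x].
  by rewrite lA scalerDr !scalerA mulrC.
by rewrite rnormZ -mulrA; apply: ler_wpM2l; rewrite ?rnorm_ge0.
Qed.

Lemma sub_bounded H G (A B : H -> G) :
  bounded_op A -> bounded_op B -> bounded_op (fun x => A x - B x).
Proof.
move=> bA /(scale_bounded (-1)) bB; have := add_bounded bA bB.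
by under eq_fun do rewrite scaleN1r.
Qed.

Lemma zero_bounded H G : bounded_op (fun _ : H => 0 : G).
Proof. by split=> [a x y|x]; [rewrite scaler0 addr0|exact: cst_continuous]. Qed.

Lemma sum_bounded H G (I : Type) (r : seq I) (f : I -> H -> G) :
  (forall i, bounded_op (f i)) -> bounded_op (fun x => \sum_(i <- r) f i x).
Proof.
move=> h; elim: r => [|i r IH].
  by under eq_fun do rewrite big_nil; exact: zero_bounded.
by under eq_fun do rewrite big_cons; exact: add_bounded.
Qed.

Lemma subspace_ker H G (A : H -> G) : bounded_op A -> closed_subspace [set x | A x = 0].
Proof.
move=> [lA cA]; have [K K0 hK] := bounded_opP lA cA.
exact: subspace_lipschitz_ker lA hK.
Qed.

Lemma subspace_preim H G (A : H -> G) (V : set G) :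
  bounded_op A -> closed_subspace V -> closed_subspace (A @^-1` V).
Proof.
move=> [lA cA] hV; have [K K0 hK] := bounded_opP lA cA.
split=> /=; last 2 first.
- by rewrite /preimage /= (lin0 lA); exact: subspace0.
- by move=> a x y Vx Vy; rewrite /preimage /= lA; case: hV => _ _; apply.
rewrite closure_id; apply/seteqP; split; first exact: subset_closure.
move=> x /closure_rnormP hx; rewrite /preimage /=.
have [cV _ _] := hV; rewrite [V](_ : V = closure V); last by apply/closure_id.
apply/closure_rnormP => e e0; have [|y /= Ay xy] := hx (e / K); first by rewrite divr_gt0.
exists (A y) => //; rewrite -(linB lA); apply: (le_trans (hK _)).
by rewrite mulrC -ler_pdivlMr.
Qed.

Lemma subspace_adj H G (A : H -> G) y z : bounded_op A ->
  closed_subspace [set x | inner (A x) y = inner x z].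
Proof.
move=> [lA cA]; have [K K0 hK] := bounded_opP lA cA.
rewrite (_ : [set x | _] = [set x | inner (A x) y - inner x z = 0]).
  apply: (@subspace_lipschitz_ker _ _ C^o (fun x => inner (A x) y - inner x z) (K * rnorm y + rnorm z)).
    by move=> a u v; rewrite lA !innerDl !innerZl scalerBr opprD addrACA.
  move=> x; apply: (le_trans (rnormD _ _)); rewrite rnormN mulrDl; apply: lerD.
    apply: (le_trans (cauchy_schwarz _ _)); rewrite mulrAC.
    by apply: ler_wpM2r; rewrite ?rnorm_ge0.
  by rewrite mulrC; exact: cauchy_schwarz.
apply/seteqP; split=> x /=; first by move=> ->; rewrite subrr.
by move/eqP; rewrite subr_eq0 => /eqP.
Qed.

(** The set of vectors at which the adjunction holds is a closed subspace, in
    each of the two arguments. *)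
Lemma adj_total H G (A : H -> G) (B : G -> H) (S : set H) (S' : set G) :
  bounded_op A -> bounded_op B ->
  closure (lspan S) = setT -> closure (lspan S') = setT ->
  (forall x y, S x -> S' y -> inner (A x) y = inner x (B y)) ->
  forall x y, inner (A x) y = inner x (B y).
Proof.
move=> bA bB tS tS' h.
have h1 x : S x -> forall y, inner (B y) x = inner y (A x).
  move=> Sx; apply: (total_ind tS' (subspace_adj _ _ bB)) => y Sy /=.
  by rewrite innerC -h // -innerC.
move=> x y; move: x; apply: (total_ind tS (subspace_adj _ _ bA)) => x Sx /=.
by rewrite innerC -h1 // -innerC.
Qed.

Lemma bounded_op_eq H G (A B : H -> G) (S : set H) :
  bounded_op A -> bounded_op B -> closure (lspan S) = setT ->
  (forall x, S x -> A x = B x) -> A = B.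
Proof.
move=> hA hB tS h; apply/funext => x; apply/eqP; rewrite -subr_eq0; apply/eqP.
apply: (total_ind tS (V := [set x | A x - B x = 0])) => [|y /h /= ->].
  exact: (subspace_ker (sub_bounded hA hB)).
by rewrite subrr.
Qed.

(** Polarization, with x + y and with i x + y. *)
Lemma isometric_inner H G (A : H -> G) :
  linear A -> isometric A -> forall x y, inner (A x) (A y) = inner x y.
Proof.
move=> lA iA.
have q x : inner (A x) (A x) = inner x x by rewrite !innerxx /rnorm iA.
have h x y : inner (A x) (A y) + inner (A y) (A x) = inner x y + inner y x.
  have := q (x + y); rewrite (linD lA) !innerDl !innerDr !q => e.
  apply: (addrI (inner x x)); apply: (addIr (inner y y)).
  by move: e; rewrite !addrA.
move=> x y.
have h1 := h x y; have := h ('i *: x) y.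
rewrite (linZ lA) !innerZl !innerZr conjCi !mulNr -!mulrBr.
move/(mulfI (neq0Ci _)) => h2.
have : inner (A x) (A y) *+ 2 = inner x y *+ 2.
  have := congr2 (fun a b => a + b) h1 h2; rewrite /= !mulr2n.
  by rewrite addrACA subrr addr0 [RHS]addrACA subrr addr0.
move: (inner (A x) (A y)) (inner x y) => a b e.
have two : (2%:R : C) != 0 by rewrite pnatr_eq0.
by apply: (mulIf two); rewrite !mulr_natr.
Qed.

Lemma adjointP H G (A : H -> G) (B : G -> H) :
  (forall x y, inner (A x) y = inner x (B y)) -> adjoint A = B.
Proof.
move=> h; apply/funext => y; rewrite /adjoint.
case: xgetP => [z -> /= hz|/(_ (B y))]; last by case=> x /=; exact: h.
apply/eqP; rewrite -subr_eq0; apply/eqP/inner_self0.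
by rewrite innerBr -hz -h subrr.
Qed.
End Ops.

(** * Orthonormal series *)

Section Orthonormal.
Variable R : realType.
Local Notation C := R[i].
Implicit Types H G : hilbertType R.

(** An orthonormal family in which the terms outside d are replaced by 0. The
    zero terms allow finite sequences, infinite sequences and enumerations
    with gaps to be treated alike, by series indexed by nat. *)
Definition quasi_orthonormal H (I : eqType) (d : pred I) (f : I -> H) : Prop :=
  forall i j, inner (f i) (f j) = ((i == j) && d i)%:R.

Lemma qon_coef H d (f : nat -> H) (c : nat -> C) p m j : quasi_orthonormal d f ->
  inner (\sum_(p <= i < m) c i *: f i) (f j) = ((p <= j < m)%N && d j)%:R * c j.
Proof.
move=> hf; rewrite inner_suml.
have [jm|jm] := boolP (p <= j < m)%N; last first.
  rewrite big_nat_cond big1 ?mul0r // => i /andP[im _].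
  rewrite innerZl hf; case: eqP => [ij|_]; last by rewrite mulr0.
  by move: jm; rewrite -ij im.
rewrite (bigD1_seq j) /=; [|by rewrite mem_index_iota|by rewrite iota_uniq].
rewrite big1 ?addr0; first by rewrite innerZl hf eqxx mulrC.
by move=> i /negbTE ij; rewrite innerZl hf ij mulr0.
Qed.

Lemma qon_rnorm H d (f : nat -> H) i : quasi_orthonormal d f -> rnorm (f i) ^+ 2 = (d i)%:R.
Proof.
move=> hf; have := hf i i; rewrite eqxx innerxx /= => e.
by case: (d i) e => /= -[].
Qed.

Lemma qon0 H d (f : nat -> H) i : quasi_orthonormal d f -> ~~ d i -> f i = 0.
Proof.
move=> /qon_rnorm -/(_ i) h /negbTE di; apply/rnorm0_eq/eqP.
by rewrite -sqrf_eq0 h di.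
Qed.

Lemma qon_norm H d (f : nat -> H) (c : nat -> C) p m : quasi_orthonormal d f ->
  rnorm (\sum_(p <= i < m) c i *: f i) ^+ 2 = \sum_(p <= i < m) rnorm (c i) ^+ 2 * (d i)%:R.
Proof.
move=> hf; elim: m => [|m IH]; first by rewrite !big_geq // rnorm0 expr0n.
have [pm|pm] := leqP p m; last by rewrite !big_geq // rnorm0 expr0n.
rewrite !big_nat_recr //= pythagoras; first by rewrite IH rnormZ exprMn (qon_rnorm _ hf).
by rewrite innerZr (qon_coef _ _ _ _ hf) ltnn andbF mul0r mulr0.
Qed.

Lemma qon_coef_real H d (f : nat -> H) x m : quasi_orthonormal d f ->
  \sum_(0 <= i < m) rnorm (inner x (f i)) ^+ 2 * (d i)%:R =
  \sum_(0 <= i < m) rnorm (inner x (f i)) ^+ 2.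
Proof.
move=> hf; apply: eq_bigr => i _; case: (boolP (d i)) => di; first by rewrite mulr1.
by rewrite (qon0 hf di) inner0r rnorm0 expr0n mulr0.
Qed.

(** The partial Fourier sum is an orthogonal component of x. *)
Lemma bessel H d (f : nat -> H) x m : quasi_orthonormal d f ->
  \sum_(0 <= i < m) rnorm (inner x (f i)) ^+ 2 <= rnorm x ^+ 2.
Proof.
move=> hf; rewrite -(qon_coef_real _ _ hf) -(qon_norm _ _ _ hf).
set y := \sum_(_ <= _ < _) _.
have -> : x = (x - y) + y by rewrite subrK.
rewrite pythagoras; first by rewrite lerDr exprn_ge0 ?rnorm_ge0.
rewrite {2}/y inner_sumr big_nat big1 // => i im.
rewrite innerZr innerBl (qon_coef _ _ _ _ hf) im /=.
case: (boolP (d i)) => di; first by rewrite mul1r subrr mulr0.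
by rewrite (qon0 hf di) inner0r mulr0 subr0 mulr0.
Qed.

(** By orthogonality the squared distance of two partial sums is the
    difference of two terms of a bounded increasing real sequence. *)
Lemma riesz_fischer H d (f : nat -> H) (c : nat -> C) (B : R) : quasi_orthonormal d f ->
  (forall m, \sum_(0 <= i < m) rnorm (c i) ^+ 2 * (d i)%:R <= B) ->
  exists y : H, (fun m => \sum_(0 <= i < m) c i *: f i) @ \oo --> y.
Proof.
move=> hf hB; apply: cauchy_rnorm_cvg => e e0.
set s := fun m => \sum_(0 <= i < m) rnorm (c i) ^+ 2 * (d i)%:R.
have [_ [N _ <-] hN] : exists2 r, range s r & sup (range s) - e ^+ 2 < r.
  apply: sup_adherent; first exact: exprn_gt0.
  by split; [exists (s 0%N), 0%N|exists B => _ [m _ <-]; exact: hB].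
have hs m : s m <= sup (range s).
  by apply: ub_le_sup; [exists B => _ [p _ <-]; exact: hB|exists m].
exists N.
suff key m p : (N <= p)%N -> (p <= m)%N ->
    rnorm (\sum_(0 <= i < m) c i *: f i - \sum_(0 <= i < p) c i *: f i) <= e.
  move=> m p Nm Np; have [mp|pm] := leqP m p; last by apply: key => //; exact: ltnW.
  by rewrite rnormBC; exact: key.
move=> Np pm; rewrite (@big_cat_nat _ _ _ p 0 m) //= addrAC subrr add0r.
rewrite -(@ler_pXn2r _ 2) ?nnegrE ?rnorm_ge0 ?(ltW e0) // (qon_norm _ _ _ hf).
have : s m <= sup (range s) by [].
rewrite /s (@big_cat_nat _ _ _ p 0 m) //= (@big_cat_nat _ _ _ N 0 p) //= => hm.
have : 0 <= \sum_(N <= i < p) rnorm (c i) ^+ 2 * (d i)%:R.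
  by apply: sumr_ge0 => i _; rewrite mulr_ge0 ?exprn_ge0 ?rnorm_ge0.
by move: hN; rewrite /s; lra.
Qed.

Lemma qon_cvg H d (f : nat -> H) (x : H) : quasi_orthonormal d f ->
  exists y : H, (fun m => \sum_(0 <= i < m) inner x (f i) *: f i) @ \oo --> y.
Proof.
move=> hf; apply: (riesz_fischer (B := rnorm x ^+ 2) hf) => m.
by rewrite (qon_coef_real _ _ hf); exact: bessel hf.
Qed.

(** The Fourier series converges by Riesz-Fischer; what it misses of x is in V
    and orthogonal to all terms of the sequence. *)
Lemma qon_expand H d (f : nat -> H) (V : set H) : quasi_orthonormal d f ->
  closed_subspace V -> (forall i, V (f i)) ->
  (forall x, V x -> (forall i, inner x (f i) = 0) -> x = 0) ->
  forall x, V x -> (fun m => \sum_(0 <= i < m) inner x (f i) *: f i) @ \oo --> x.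
Proof.
move=> hf hV fV h0 x Vx; have [y hy] := qon_cvg x hf.
suff e : x = y by rewrite [X in _ --> X]e; exact: hy.
have Vy : V y.
  by apply: (subspace_cvg hV _ hy) => m; apply: subspace_sum => // i _ _; apply: subspaceZ.
apply/eqP; rewrite -subr_eq0; apply/eqP; apply: h0; first exact: subspaceB.
move=> j; rewrite innerBl; apply/eqP; rewrite subr_eq0; apply/eqP.
symmetry; apply: (cvg_inner_eq hy); exists j.+1 => m jm.
rewrite (qon_coef _ _ _ _ hf) /= jm.
by case: (boolP (d j)) => dj; rewrite ?mul1r // (qon0 hf dj) inner0r mulr0.
Qed.

Lemma qon_total H d (f : nat -> H) (hf : quasi_orthonormal d f)
    (tf : closure (lspan (range f)) = setT) (x : H) :
  (fun m => \sum_(0 <= i < m) inner x (f i) *: f i) @ \oo --> x.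
Proof.
apply: (qon_expand (V := setT) hf) => //.
move=> y _ hy; apply: (total_orth0 tf) => _ [i _ <-]; exact: inner_eq0C.
Qed.

Arguments qon_total {H d f} hf tf x.

(** A x is the limit of the images of the partial Fourier sums of x; the bound
    on finite sums makes these images a Cauchy sequence. *)
Lemma extend_along_sequence H G d (f : nat -> H) (g : nat -> G) (K : R) :
  quasi_orthonormal d f -> closure (lspan (range f)) = setT -> 0 <= K ->
  (forall m (c : nat -> C), rnorm (\sum_(0 <= i < m) c i *: g i) <=
     K * rnorm (\sum_(0 <= i < m) c i *: f i)) ->
  exists A : H -> G, bounded_op A /\ forall i, A (f i) = g i.
Proof.
move=> hf tf K0 hK.
have hK2 p m (c : nat -> C) : rnorm (\sum_(p <= i < m) c i *: g i) <=
     K * rnorm (\sum_(p <= i < m) c i *: f i).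
  have [pm|pm] := leqP p m; last by rewrite !big_geq ?(ltnW pm) // !rnorm0 mulr0.
  have h (U : lmodType C) (u : nat -> U) : \sum_(p <= i < m) c i *: u i =
      \sum_(0 <= i < m) (if (p <= i)%N then c i else 0) *: u i.
    rewrite [RHS](@big_cat_nat _ _ _ p 0 m) //= [X in _ = X + _]big_nat [X in _ = X + _]big1 ?add0r.
      by apply: eq_big_nat => i /andP[-> _].
    by move=> i /andP[_ ip]; rewrite leqNgt ip scale0r.
  by rewrite !h; exact: hK.
have lim x : exists y : G, (fun m => \sum_(0 <= i < m) inner x (f i) *: g i) @ \oo --> y.
  apply: cauchy_rnorm_cvg => e e0.
  have K1 : 0 < K + 1 by rewrite ltr_wpDl.
  have /cvg_rnormP/(_ (e / (K + 1) / 2)) [|N hN] := qon_total hf tf x.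
    by rewrite !divr_gt0.
  have hN' p m : (N <= p)%N -> (p <= m)%N ->
      rnorm (\sum_(0 <= i < m) inner x (f i) *: g i - \sum_(0 <= i < p) inner x (f i) *: g i) <= e.
    move=> Np pm; rewrite (@big_cat_nat _ _ _ p 0 m) //= addrAC subrr add0r.
    apply: (le_trans (hK2 _ _ _)).
    have h : rnorm (\sum_(p <= i < m) inner x (f i) *: f i) <= e / (K + 1).
      have -> : \sum_(p <= i < m) inner x (f i) *: f i =
         (x - \sum_(0 <= i < p) inner x (f i) *: f i) -
         (x - \sum_(0 <= i < m) inner x (f i) *: f i).
        by rewrite [X in _ = _ - (_ - X)](@big_cat_nat _ _ _ p 0 m) //= opprB [RHS]addrC addrA subrK addrAC subrr add0r.
      apply: (le_trans (rnormD _ _)); rewrite rnormN [leRHS]splitr.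
      by apply: lerD; apply: hN => //; exact: leq_trans pm.
    apply: (@le_trans _ _ ((K + 1) * rnorm (\sum_(p <= i < m) inner x (f i) *: f i))).
      by apply: ler_wpM2r; rewrite ?rnorm_ge0 // lerDl.
    by rewrite mulrC -ler_pdivlMr.
  exists N => m p Nm Np; have [mp|pm] := leqP m p; last by apply: hN' => //; exact: ltnW.
  by rewrite rnormBC; exact: hN'.
have [A hA] := choice lim.
exists A; split.
  have lA : linear A.
    move=> a x y; apply: (cvg_nat_unique (hA _)).
    have -> : (fun m => \sum_(0 <= i < m) inner (a *: x + y) (f i) *: g i) =
      (fun m => a *: (\sum_(0 <= i < m) inner x (f i) *: g i)) \+
      (fun m => \sum_(0 <= i < m) inner y (f i) *: g i).
      apply/funext => m /=; rewrite scaler_sumr -big_split /=; apply: eq_bigr => i _.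
      by rewrite innerDl innerZl scalerDl scalerA.
    apply: cvgD; last exact: hA.
    by apply: (@lipschitz_cvg _ _ _ ( *:%R a) (rnorm a)); [move=> u v; rewrite -scalerBr rnormZ|exact: hA].
  apply: (@bounded_opI _ _ _ _ K) => // x.
  rewrite -subr_le0; apply: le0_of_le_eps => e e0.
  have /cvg_rnormP/(_ _ e0) [N /(_ N (leqnn N)) hN] := hA x.
  rewrite lerBlDr; have := rnormD (A x - \sum_(0 <= i < N) inner x (f i) *: g i) (\sum_(0 <= i < N) inner x (f i) *: g i).
  rewrite subrK => h; apply: (le_trans h); apply: lerD => //.
  apply: (le_trans (hK2 _ _ _)); apply: ler_wpM2l => //.
  rewrite -(@ler_pXn2r _ 2) ?nnegrE ?rnorm_ge0 // (qon_norm _ _ _ hf) (qon_coef_real _ _ hf).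
  exact: bessel hf.
move=> i; apply: (cvg_nat_unique (hA _)).
apply/cvg_rnormP => e e0; exists i.+1 => m im.
have g0 : ~~ d i -> g i = 0.
  move=> di; apply/rnorm0_eq/eqP; rewrite eq_le rnorm_ge0 andbT.
  have := hK2 i i.+1 (fun=> 1); rewrite !big_nat1 !scale1r (qon0 hf di) rnorm0 mulr0 //.
rewrite (bigD1_seq i) /=; [|by rewrite mem_index_iota|by rewrite iota_uniq].
rewrite big1 ?addr0; last by move=> j /negbTE ij; rewrite hf eq_sym ij scale0r.
rewrite hf eqxx /=; case: (boolP (d i)) => di.
  by rewrite scale1r subrr rnorm0 ltW.
by rewrite g0 // scaler0 subrr rnorm0 ltW.
Qed.

(** The vector representing the functional x |-> <A x, y> is the series of
    coefficients <y, A f_i>. Its partial sums z are bounded because |z|^2 =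
    <y, A z> <= K |y| |z|. *)
Lemma adjoint_exists H G d (f : nat -> H) (A : H -> G) :
  quasi_orthonormal d f -> closure (lspan (range f)) = setT -> bounded_op A ->
  forall x y, inner (A x) y = inner x (adjoint A y).
Proof.
move=> hf tf bA; have [lA cA] := bA; have [K K0 hK] := bounded_opP lA cA.
have lim y : exists z : H, (fun m => \sum_(0 <= i < m) inner y (A (f i)) *: f i) @ \oo --> z.
  apply: (riesz_fischer (B := (K * rnorm y) ^+ 2) hf) => m.
  set s := \sum_(_ <= _ < _) _.
  set z := \sum_(0 <= i < m) inner y (A (f i)) *: f i.
  have es : s = rnorm z ^+ 2 by rewrite (qon_norm _ _ _ hf).
  have e : inner y (A z) = s%:C.
    rewrite /z (linear_bigsum lA) inner_sumr /s rc_sum; apply: eq_bigr => i _.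
    rewrite (linZ lA) innerZr mulrC mul_conjE rcM.
    case: (boolP (d i)) => di; first by rewrite mulr1.
    by rewrite (qon0 hf di) (lin0 lA) inner0r rnorm0 expr0n mul0r.
  have : rnorm (inner y (A z)) <= rnorm y * (K * rnorm z).
    apply: (le_trans (cauchy_schwarz _ _)).
    by apply: ler_wpM2l; rewrite ?rnorm_ge0.
  rewrite e rnorm_realC es ger0_norm ?exprn_ge0 ?rnorm_ge0 // => h.
  have [z0|z0] := eqVneq (rnorm z) 0; first by rewrite z0 expr0n exprn_ge0 // mulr_ge0 ?rnorm_ge0 // ltW.
  have {z0}z0 : 0 < rnorm z by rewrite lt_neqAle eq_sym z0 rnorm_ge0.
  rewrite ler_pXn2r ?nnegrE ?rnorm_ge0 //; last by rewrite mulr_ge0 ?rnorm_ge0 // ltW.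
  by move: h; rewrite expr2 mulrA [rnorm y * K]mulrC ler_pM2r.
have [B hB] := choice lim.
suff h x y : inner (A x) y = inner x (B y) by rewrite (adjointP h).
have hx := qon_total hf tf x.
have h1 := @inner_cvgl _ _ _ _ y (op_cvg bA hx).
apply: (cvg_nat_unique h1).
have h2 := @inner_cvgl _ _ _ _ (B y) hx.
suff -> : (fun m => inner ((A \o (fun m => \sum_(0 <= i < m) inner x (f i) *: f i)) m) y) =
          (fun m => inner (\sum_(0 <= i < m) inner x (f i) *: f i) (B y)) by [].
apply/funext => m /=; rewrite (linear_bigsum lA) !inner_suml; apply: eq_bigr => i _.
rewrite (linZ lA) !innerZl; congr (_ * _).
rewrite [RHS]innerC innerC; congr (_^*); symmetry.
apply: (cvg_inner_eq (hB y)); exists i.+1 => p ip.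
rewrite (qon_coef _ _ _ _ hf) /= ip.
case: (boolP (d i)) => di; first by rewrite mul1r.
by rewrite (qon0 hf di) (lin0 lA) inner0r mulr0.
Qed.

Lemma adjoint_bounded H G (A : H -> G) (B : G -> H) :
  bounded_op A -> (forall x y, inner (A x) y = inner x (B y)) -> bounded_op B.
Proof.
move=> [lA cA] h; have [K K0 hK] := bounded_opP lA cA.
apply: (@bounded_opI _ _ _ _ K) => [a x y|y].
  apply/eqP; rewrite -subr_eq0; apply/eqP/inner_self0.
  by rewrite innerBr innerDr innerZr -!h innerDr innerZr subrr.
have [z0|z0] := eqVneq (rnorm (B y)) 0; first by rewrite z0 mulr_ge0 ?rnorm_ge0 // ltW.
have {z0}z0 : 0 < rnorm (B y) by rewrite lt_neqAle eq_sym z0 rnorm_ge0.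
rewrite -(ler_pM2r z0) -expr2.
have : rnorm (inner (A (B y)) y) = rnorm (B y) ^+ 2.
  by rewrite h innerxx rnorm_realC ger0_norm // exprn_ge0 // rnorm_ge0.
move=> <-; apply: (le_trans (cauchy_schwarz _ _)).
rewrite mulrC [K * _]mulrC -mulrA; apply: ler_wpM2l; rewrite ?rnorm_ge0 //.
Qed.
End Orthonormal.

(** * Orthogonal projections *)

Section Projection.
Variable R : realType.
Local Notation C := R[i].
Variable H : hilbertType R.

(** Moving z along w in the direction of <z, w> makes the term of first order
    in t real, and nonpositive for t >= 0. *)
Lemma rnorm_sub_proj (z w : H) (t : R) (c := inner z w) :
  rnorm (z - (t%:C * c) *: w) ^+ 2 = rnorm z ^+ 2 - 2 * t * rnorm c ^+ 2 + t ^+ 2 * rnorm c ^+ 2 * rnorm w ^+ 2.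
Proof.
suff : ((rnorm (z - (t%:C * c) *: w) ^+ 2)%:C : C) = (rnorm z ^+ 2 - 2 * t * rnorm c ^+ 2 + t ^+ 2 * rnorm c ^+ 2 * rnorm w ^+ 2)%:C by case.
rewrite rcD rcB (rcM (2 * t)) (rcM (t ^+ 2 * rnorm c ^+ 2)) (rcM (t ^+ 2)) (rcM 2) -!innerxx -!mul_conjE rcX.
rewrite !innerBl !innerBr !innerZl !innerZr (innerC w z) -/c rmorphM /= rc_conj rcD.
by move: (c^*) => c'; rewrite rc1; ring.
Qed.

(** The nearest point exists because minimizing sequences are Cauchy, by the
    parallelogram law. Moving the nearest point along w in M cannot decrease
    the distance, and this forces orthogonality. *)
Lemma projection_exists (M : set H) : closed_subspace M ->
  forall x, exists y, M y /\ forall m, M m -> inner (x - y) m = 0.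
Proof.
move=> hM x.
pose S := [set (rnorm (x - m)) ^+ 2 | m in M].
have S0 : has_inf S.
  split; first by exists (rnorm (x - 0) ^+ 2); exists 0 => //; exact: subspace0.
  by exists 0 => _ [m _ <-]; rewrite exprn_ge0 // rnorm_ge0.
have Sd m : M m -> inf S <= rnorm (x - m) ^+ 2.
  by move=> Mm; apply: ge_inf; [case: S0|exists m].
have ex (p : nat) : exists m, M m /\ rnorm (x - m) ^+ 2 < inf S + p.+1%:R^-1.
  have [|_ [m Mm <-] h] := @inf_adherent _ S p.+1%:R^-1 _ S0; last by exists m.
  by rewrite invr_gt0 ltr0n.
have [u hu] := choice ex.
have key p q : rnorm (u p - u q) ^+ 2 <= 2 * p.+1%:R^-1 + 2 * q.+1%:R^-1.
  have := parallelogram (x - u q) (x - u p).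
  have -> : x - u q - (x - u p) = u p - u q.
    by rewrite opprB addrC addrA subrK.
  have -> : x - u q + (x - u p) = (2%:R : C) *: (x - (2%:R^-1 : C) *: (u p + u q)).
    rewrite scalerBr scalerA divff ?pnatr_eq0 // scale1r scaler_nat mulr2n.
    by rewrite addrACA opprD [- u q - u p]addrC.
  have Mm : M ((2%:R^-1 : C) *: (u p + u q)).
    by apply: subspaceZ => //; apply: subspaceD => //; [case: (hu p)|case: (hu q)].
  have := Sd _ Mm; rewrite rnormZ.
  have -> : rnorm (2%:R : C) = 2.
    by rewrite (_ : 2%:R = (2%:R : R)%:C) ?rnorm_realC ?ger0_norm // [RHS]rmorph_nat.
  rewrite exprMn; have [_ hp] := hu p; have [_ hq] := hu q.
  move: hp hq; set a := rnorm (x - u p) ^+ 2; set b := rnorm (x - u q) ^+ 2.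
  set c := rnorm (x - _) ^+ 2; set s := rnorm (u p - u q) ^+ 2.
  by move: (p.+1%:R^-1) (q.+1%:R^-1) => P Q; lra.
have [|y hy] := @cauchy_rnorm_cvg _ H u.
  move=> e e0.
  have [N hN] : exists N : nat, (4 / e ^+ 2) < N%:R.
    by exists (Num.bound (4 / e ^+ 2)); apply: archi_boundP; rewrite divr_ge0 // exprn_ge0 // ltW.
  exists N => m p Nm Np.
  rewrite -(@ler_pXn2r _ 2) ?nnegrE ?rnorm_ge0 ?(ltW e0) //.
  apply: (le_trans (key _ _)).
  have e2 : 0 < e ^+ 2 by rewrite exprn_gt0.
  have h q : (N <= q)%N -> (q.+1%:R^-1 : R) <= e ^+ 2 / 4.
    move=> Nq; have hq : 4 / e ^+ 2 <= q.+1%:R.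
      by apply: (le_trans (ltW hN)); rewrite ler_nat; lia.
    rewrite -[leRHS]invrK invf_div lef_pV2 // posrE ?ltr0n // divr_gt0 //.
  by have := h _ Nm; have := h _ Np; move: (m.+1%:R^-1) (p.+1%:R^-1) => P Q; lra.
have My : M y by apply: (subspace_cvg hM _ hy) => m; case: (hu m).
have min m : M m -> rnorm (x - y) <= rnorm (x - m).
  move=> Mm.
  rewrite -subr_le0; apply: le0_of_le_eps => e e0.
  have /cvg_rnormP/(_ (e / 2)) [|N1 h1] := hy; first by rewrite divr_gt0.
  pose c := 2 * rnorm (x - m) * (e / 2) + (e / 2) ^+ 2.
  have c0 : 0 < c by rewrite ltr_wpDl ?exprn_gt0 ?divr_gt0 // mulr_ge0 ?mulr_ge0 ?rnorm_ge0 // ltW ?divr_gt0.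
  have [N2 h2] : exists N : nat, c^-1 < N%:R.
    by exists (Num.bound c^-1); apply: archi_boundP; rewrite invr_ge0 ltW.
  pose N := maxn N1 N2.
  have a1 : rnorm (u N - y) <= e / 2 by rewrite rnormBC; apply: h1; exact: leq_maxl.
  have a2 : rnorm (x - u N) <= rnorm (x - m) + e / 2.
    have e2 : 0 <= rnorm (x - m) + e / 2 by rewrite addr_ge0 ?rnorm_ge0 // ltW ?divr_gt0.
    rewrite -(@ler_pXn2r _ 2) ?nnegrE ?rnorm_ge0 //.
    have [_ /ltW hN] := hu N; apply: (le_trans hN).
    have : N.+1%:R^-1 <= c.
      rewrite -[leRHS]invrK lef_pV2 ?posrE ?ltr0n ?invr_gt0 //.
      apply: (le_trans (ltW h2)); rewrite ler_nat; apply: leqW; exact: leq_maxr.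
    by have := Sd _ Mm; rewrite /c; move: (N.+1%:R^-1) => Q; rewrite sqrrD mulr2n; lra.
  have := rnormD (x - u N) (u N - y); rewrite addrA subrK => h.
  rewrite lerBlDr; apply: (le_trans h); lra.
exists y; split=> // w Mw.
set z := x - y; set c := inner z w.
(* small enough for the quadratic term in t to be dominated by the linear one *)
pose t := (rnorm w ^+ 2 + 1)^-1.
have t0 : 0 < t by rewrite invr_gt0 ltr_wpDl // exprn_ge0 // rnorm_ge0.
have h : rnorm z ^+ 2 <= rnorm (z - (t%:C * c) *: w) ^+ 2.
  rewrite ler_pXn2r ?nnegrE ?rnorm_ge0 // /z -addrA -opprD; apply: min.
  by apply: subspaceD => //; exact: subspaceZ.
have e := rnorm_sub_proj z w t; rewrite -/c in e.
have c0 : rnorm c ^+ 2 * (2 * t - t ^+ 2 * rnorm w ^+ 2) <= 0 by move: h; rewrite e; lra.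
have h3 : 0 < 2 * t - t ^+ 2 * rnorm w ^+ 2.
  have -> : 2 * t - t ^+ 2 * rnorm w ^+ 2 = t * (2 - t * rnorm w ^+ 2) by ring.
  rewrite mulr_gt0 // subr_gt0; apply: (@lt_trans _ _ 1) => //; last by rewrite ltr1n.
  by rewrite /t mulrC ltr_pdivrMr ?mul1r ?ltrDl // ltr_wpDl // exprn_ge0 // rnorm_ge0.
apply/rnorm0_eq/eqP; rewrite -sqrf_eq0 eq_le exprn_ge0 ?rnorm_ge0 // andbT.
by move: c0; rewrite pmulr_lle0.
Qed.

Lemma orth_projP (M : set H) x : closed_subspace M ->
  M (orth_proj M x) /\ forall m, M m -> inner (x - orth_proj M x) m = 0.
Proof.
move=> hM; rewrite /orth_proj; case: xgetP => [y _ //|].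
by have [y hy /(_ y)] := projection_exists hM x.
Qed.

Lemma orth_proj_uniq (M : set H) x y : closed_subspace M ->
  M y -> (forall m, M m -> inner (x - y) m = 0) -> orth_proj M x = y.
Proof.
move=> hM My hy; have [Mp hp] := orth_projP x hM.
have Md : M (orth_proj M x - y) by exact: subspaceB.
apply/eqP; rewrite -subr_eq0; apply/eqP/inner_self0.
have -> : inner (orth_proj M x - y) (orth_proj M x - y) =
  inner (x - y) (orth_proj M x - y) - inner (x - orth_proj M x) (orth_proj M x - y).
  by rewrite -innerBl opprB [x - y + _]addrC addrA subrK.
by rewrite hy // hp // subr0.
Qed.

Lemma orth_proj_in (M : set H) x : closed_subspace M -> M (orth_proj M x).
Proof. by move=> /(orth_projP x) []. Qed.

Lemma orth_proj_id (M : set H) x : closed_subspace M -> M x -> orth_proj M x = x.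
Proof. by move=> hM Mx; apply: orth_proj_uniq => // m _; rewrite subrr inner0l. Qed.

Lemma orth_proj_sa (M : set H) x y : closed_subspace M ->
  inner (orth_proj M x) y = inner x (orth_proj M y).
Proof.
move=> hM; have [Mx hx] := orth_projP x hM; have [My hy] := orth_projP y hM.
have /eqP := hx _ My; rewrite innerBl subr_eq0 => /eqP ->.
have /eqP := inner_eq0C (hy _ Mx); rewrite innerBr subr_eq0 => /eqP ->.
by [].
Qed.

Lemma orth_proj_le (M : set H) x : closed_subspace M -> rnorm (orth_proj M x) <= rnorm x.
Proof.
move=> hM; have [Mx hx] := orth_projP x hM.
rewrite -(@ler_pXn2r _ 2) ?nnegrE ?rnorm_ge0 //.
rewrite -{2}[x](subrK (orth_proj M x)) pythagoras ?hx //.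
by rewrite lerDr exprn_ge0 // rnorm_ge0.
Qed.

Lemma orth_proj_bounded (M : set H) : closed_subspace M -> bounded_op (orth_proj M).
Proof.
move=> hM; apply: (@bounded_opI _ _ _ _ 1) => [a x y|x]; last by rewrite mul1r orth_proj_le.
apply: orth_proj_uniq => //.
  by apply: subspaceD => //; [apply: subspaceZ => //|]; exact: orth_proj_in.
move=> m Mm; rewrite innerBl !innerDl !innerZl.
have [_ hx] := orth_projP x hM; have [_ hy] := orth_projP y hM.
have /eqP := hx _ Mm; rewrite innerBl subr_eq0 => /eqP ->.
have /eqP := hy _ Mm; rewrite innerBl subr_eq0 => /eqP ->.
by rewrite subrr.
Qed.
End Projection.

(** * Orthonormalization *)

Section GramSchmidt.
Variable R : realType.
Local Notation C := R[i].
Variable H : hilbertType R.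
Variable x : nat -> H.

(** As normalize 0 = 0, orthonormalizing linearly dependent vectors produces
    zero vectors instead of failing. *)
Definition normalize (v : H) : H := ((rnorm v)^-1)%:C *: v.

(** The vectors already produced are kept in a list, which makes the recursion
    structural. *)
Fixpoint gs_prefix (m : nat) : seq H :=
  if m is p.+1 then
    rcons (gs_prefix p) (normalize (x p - \sum_(y <- gs_prefix p) inner (x p) y *: y))
  else [::].

Definition gram_schmidt (p : nat) : H := nth 0 (gs_prefix p.+1) p.

Lemma size_gs m : size (gs_prefix m) = m.
Proof. by elim: m => //= m IH; rewrite size_rcons IH. Qed.

Lemma gs_prefixE m : gs_prefix m = mkseq gram_schmidt m.
Proof.
elim: m => // m IH; rewrite mkseqS -IH /gram_schmidt /=.
by rewrite nth_rcons size_gs ltnn eqxx.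
Qed.

Definition gs_res p := x p - \sum_(0 <= i < p) inner (x p) (gram_schmidt i) *: gram_schmidt i.

Lemma gram_schmidtE p : gram_schmidt p = normalize (gs_res p).
Proof.
rewrite /gram_schmidt /= nth_rcons size_gs ltnn eqxx gs_prefixE /mkseq big_map.
by rewrite /gs_res /index_iota subn0.
Qed.

Lemma rnorm_normalize v : rnorm (normalize v) ^+ 2 = (normalize v != 0)%:R.
Proof.
have [v0|v0] := eqVneq (rnorm v) 0.
  by rewrite /normalize v0 invr0 scale0r eqxx rnorm0 expr0n.
have h : rnorm (normalize v) = 1.
  by rewrite /normalize rnormZ rnorm_realC ger0_norm ?invr_ge0 ?rnorm_ge0 // mulVf.
rewrite h expr1n; case: eqP => // e0; move: h; rewrite e0 rnorm0 => /eqP.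
by rewrite eq_sym oner_eq0.
Qed.

Lemma gram_schmidt_qon : quasi_orthonormal (fun i => gram_schmidt i != 0) gram_schmidt.
Proof.
have key m i j : (i < m)%N -> (j < m)%N ->
    inner (gram_schmidt i) (gram_schmidt j) = ((i == j) && (gram_schmidt i != 0))%:R.
  elim: m i j => // m IH.
  have h j : (j < m)%N -> inner (gram_schmidt m) (gram_schmidt j) = 0.
    move=> jm; rewrite gram_schmidtE innerZl innerBl inner_suml.
    rewrite (bigD1_seq j) /=; [|by rewrite mem_index_iota|by rewrite iota_uniq].
    rewrite big_nat_cond big1 ?addr0.
      rewrite innerZl IH // eqxx /=; case: eqP => [->|_]; last by rewrite mulr1 subrr mulr0.
      by rewrite inner0r mulr0 subr0 mulr0.
    by move=> i /andP[/andP[_ im] /negbTE ij]; rewrite innerZl IH // ij mulr0.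
  move=> i j; rewrite !ltnS leq_eqVlt => /orP[/eqP ->|im];
    rewrite leq_eqVlt => /orP[/eqP ->|jm].
  - by rewrite eqxx innerxx {1}gram_schmidtE rnorm_normalize -gram_schmidtE; case: eqP.
  - by rewrite h // gtn_eqF.
  - by rewrite inner_eq0C ?h // ltn_eqF.
  - exact: IH.
move=> i j; apply: (key (maxn i j).+1); rewrite ltnS; [exact: leq_maxl|exact: leq_maxr].
Qed.

Lemma gram_schmidt_in (V : set H) : closed_subspace V -> (forall i, V (x i)) ->
  forall i, V (gram_schmidt i).
Proof.
move=> hV xV i; elim/ltn_ind: i => i IH.
rewrite gram_schmidtE; apply: subspaceZ => //; apply: subspaceB => //.
apply: subspace_sum => // j; rewrite mem_index_iota => ji _; apply: subspaceZ => //; exact: IH.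
Qed.

Lemma gram_schmidt_orth y : (forall i, inner y (gram_schmidt i) = 0) ->
  forall i, inner y (x i) = 0.
Proof.
move=> h i.
have -> : x i = gs_res i + \sum_(0 <= j < i) inner (x i) (gram_schmidt j) *: gram_schmidt j.
  by rewrite subrK.
rewrite innerDr inner_sumr big1 ?addr0; last by move=> j _; rewrite innerZr h mulr0.
have [v0|v0] := eqVneq (rnorm (gs_res i)) 0; first by rewrite (rnorm0_eq v0) inner0r.
have -> : gs_res i = (rnorm (gs_res i))%:C *: gram_schmidt i.
  by rewrite gram_schmidtE /normalize scalerA -rcM divff // scale1r.
by rewrite innerZr h mulr0.
Qed.
End GramSchmidt.

Section OrthonormalBasis.
Variable R : realType.
Local Notation C := R[i].
Variable H : hilbertType R.

Definition pad (N : option nat) (f : nat -> H) s := if lt_len s N then f s else 0.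

Lemma pad_qon N (f : nat -> H) :
  (forall s t, lt_len s N -> lt_len t N -> inner (f s) (f t) = (s == t)%:R) ->
  quasi_orthonormal (lt_len ^~ N) (pad N f).
Proof.
move=> h s t; rewrite /pad; case: ifP => hs; case: ifP => ht; rewrite ?inner0l ?inner0r ?andbF //.
- by rewrite h // andbT.
- by rewrite andbT; case: eqP => // st; move: hs ht; rewrite st => ->.
Qed.

(** Any set of natural numbers is in bijection with an initial segment of nat,
    possibly all of nat; this removes the zero vectors left by the Gram-
    Schmidt process. *)
Lemma enumerate_nat_set (D : set nat) : exists (N : option nat) (r : nat -> nat),
  [/\ forall s, lt_len s N -> D (r s),
      forall s t, lt_len s N -> lt_len t N -> r s = r t -> s = t &
      forall i, D i -> exists2 s, lt_len s N & r s = i].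
Proof.
have [N hN] : exists N, (D #= [set s | lt_len s N])%card.
  have [/finite_setP[m hm]|infD] := pselect (finite_set D).
    by exists (Some m).
  have h : (D #= [set: nat])%card by apply: eq_card_nat => //; exact: countableP.
    by exists None; rewrite (_ : [set s | _] = setT) //; apply/seteqP; split.
exists N.
move: hN; rewrite card_eq_sym => /card_set_bijP [r [rD rinj rsurj]].
exists r; split.
- by move=> s hs; apply: rD.
- by move=> s t hs ht; apply: rinj; rewrite inE.
- by move=> i /rsurj [s hs <-]; exists s.
Qed.

(** The Gram-Schmidt process, followed by the removal of the zero vectors. *)
Lemma onb_exists (V : set H) (x : nat -> H) : closed_subspace V ->
  (forall i, V (x i)) -> (forall y, V y -> (forall i, inner y (x i) = 0) -> y = 0) ->
  exists N psi,
   [/\ forall s, lt_len s N -> V (psi s),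
       forall s t, lt_len s N -> lt_len t N -> inner (psi s) (psi t) = (s == t)%:R &
       forall y, V y -> (forall s, lt_len s N -> inner y (psi s) = 0) -> y = 0].
Proof.
move=> hV xV h0.
have [N [r [rD rinj rsurj]]] := enumerate_nat_set [set i | gram_schmidt x i != 0].
exists N, (gram_schmidt x \o r); split.
- by move=> s _; exact: gram_schmidt_in.
- move=> s t hs ht /=; rewrite gram_schmidt_qon (rD _ hs) andbT.
  by congr (nat_of_bool _)%:R; apply/eqP/eqP => [|-> //]; exact: rinj.
- move=> y Vy h; apply: h0 => //; apply: gram_schmidt_orth => i.
  have [->|/rsurj [s hs <-]] := eqVneq (gram_schmidt x i) 0; first by rewrite inner0r.
  exact: h.
Qed.
End OrthonormalBasis.

(** * Bases indexed by countable types *)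

Section CountableBasis.
Variable R : realType.
Local Notation C := R[i].

(** The component of a vector which is orthogonal to the closed span vanishes. *)
Lemma total_of_orth0 (H : hilbertType R) (A : set H) :
  (forall y, (forall x, A x -> inner x y = 0) -> y = 0) -> closure (lspan A) = setT.
Proof.
move=> h; apply/seteqP; split=> // x _.
have hM := subspace_closure_lspan A; have [Mp hp] := orth_projP x hM.
suff e : x - orth_proj (closure (lspan A)) x = 0.
  by move/eqP: e; rewrite subr_eq0 => /eqP ->.
apply: h => y Ay; apply: inner_eq0C; apply: hp.
by apply: subset_closure; exact: lspan_in.
Qed.

Variable I : countType.
Variables (H : hilbertType R) (g : I -> H).

Lemma qon_finite_norm (G : hilbertType R) dd (h : I -> G) (c : I -> C) (s : seq I) :
  quasi_orthonormal dd h -> uniq s ->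
  rnorm (\sum_(i <- s) c i *: h i) ^+ 2 = \sum_(i <- s) rnorm (c i) ^+ 2 * (dd i)%:R.
Proof.
move=> hh; elim: s => [|i s IH] /= us; first by rewrite !big_nil rnorm0 expr0n.
have /andP[is_ {}us] := us.
rewrite !big_cons pythagoras.
  rewrite IH // rnormZ exprMn; congr (_ * _ + _).
  have := hh i i; rewrite eqxx innerxx /= => e.
  by case: (dd i) e => /= -[].
rewrite inner_sumr big_seq big1 // => j js; rewrite innerZl innerZr hh.
case: eqP => [ij|_]; last by rewrite !mulr0.
by move: is_; rewrite ij js.
Qed.

(** The numbers which code no element of the countable index type I give the
    value 0. *)
Definition enum_family (G : hilbertType R) (h : I -> G) (m : nat) : G := oapp h 0 (@pickle_inv I m).

Lemma enum_family_qon : quasi_orthonormal predT g ->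
  quasi_orthonormal (fun m => isSome (@pickle_inv I m)) (enum_family g).
Proof.
move=> hg i j; rewrite /enum_family.
have [<-|ij] /= := eqVneq i j.
  by case: (@pickle_inv I i) => [w|] /=; rewrite ?inner0l // hg eqxx.
have := @pickle_invK I i; have := @pickle_invK I j; move: ij.
case: (@pickle_inv I i) => [w|]; case: (@pickle_inv I j) => [v|] /=; rewrite ?inner0l ?inner0r //.
by move=> + hj hi; rewrite -hj -hi hg; case: (eqVneq w v) => [->|//]; rewrite eqxx.
Qed.

Lemma enum_family_pickle (G : hilbertType R) (h : I -> G) w :
  enum_family h (choice.pickle w) = h w.
Proof. by rewrite /enum_family pickleK_inv. Qed.

Lemma enum_family_total : closure (lspan (range g)) = setT ->
  closure (lspan (range (enum_family g))) = setT.
Proof.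
move=> tg; apply: total_of_orth0 => y hy; apply: (total_orth0 tg) => _ [w _ <-].
by rewrite -enum_family_pickle; apply: hy; exists (choice.pickle w).
Qed.

Lemma sum_enum_family (G : hilbertType R) (h : I -> G) (c : nat -> C) m :
  \sum_(0 <= i < m) c i *: enum_family h i =
  \sum_(w <- pmap (@pickle_inv I) (iota 0 m)) c (choice.pickle w) *: h w.
Proof.
rewrite /index_iota subn0; elim: (iota 0 m) => [|i s IH]; first by rewrite !big_nil.
rewrite big_cons /= IH /enum_family.
have := @pickle_invK I i; case: (@pickle_inv I i) => [w|] /=; last by rewrite scaler0 add0r.
by move=> <-; rewrite big_cons.
Qed.

Lemma pmap_pickle_uniq m : uniq (pmap (@pickle_inv I) (iota 0 m)).
Proof. by apply: (pmap_uniq (@pickle_invK I)); exact: iota_uniq. Qed.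

Lemma extend_along_basis (G : hilbertType R) (h : I -> G) (K : R) :
  quasi_orthonormal predT g -> closure (lspan (range g)) = setT -> 0 <= K ->
  (forall (s : seq I) (c : I -> C), uniq s ->
     rnorm (\sum_(i <- s) c i *: h i) <= K * rnorm (\sum_(i <- s) c i *: g i)) ->
  exists A : H -> G, bounded_op A /\ forall i, A (g i) = h i.
Proof.
move=> hg tg K0 hK.
have [|A [bA hA]] := @extend_along_sequence _ _ _ _ _ (enum_family h) K (enum_family_qon hg) (enum_family_total tg) K0.
  by move=> m c; rewrite !sum_enum_family; apply: (hK _ (c \o choice.pickle)); exact: pmap_pickle_uniq.
by exists A; split=> // w; rewrite -!enum_family_pickle.
Qed.

(** When the images are orthonormal or zero, the bound on finite sums is the
    Pythagorean theorem. *)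
Lemma extend_contraction (G : hilbertType R) (h : I -> G) dd :
  quasi_orthonormal predT g -> closure (lspan (range g)) = setT -> quasi_orthonormal dd h ->
  exists A : H -> G, bounded_op A /\ forall i, A (g i) = h i.
Proof.
move=> hg tg hh; apply: (@extend_along_basis _ h 1) => // s c us; rewrite mul1r.
rewrite -(@ler_pXn2r _ 2) ?nnegrE ?rnorm_ge0 // (qon_finite_norm _ hg us) (qon_finite_norm _ hh us).
apply: ler_sum => i _; apply: ler_wpM2l; first by rewrite exprn_ge0 // rnorm_ge0.
by rewrite ler_nat leq_b1.
Qed.

Lemma basis_eq (x y : H) : closure (lspan (range g)) = setT ->
  (forall i, inner x (g i) = inner y (g i)) -> x = y.
Proof.
move=> tg h; apply/eqP; rewrite -subr_eq0; apply/eqP.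
apply: (total_orth0 tg) => _ [i _ <-]; apply: inner_eq0C.
by rewrite innerBl h subrr.
Qed.

Lemma op_eq_basis (G : hilbertType R) (A B : H -> G) : closure (lspan (range g)) = setT ->
  bounded_op A -> bounded_op B -> (forall i, A (g i) = B (g i)) -> A = B.
Proof. by move=> tg bA bB h; apply: (bounded_op_eq bA bB tg) => _ [i _ <-]. Qed.

Lemma op_adj_basis (G : hilbertType R) (A : H -> G) :
  quasi_orthonormal predT g -> closure (lspan (range g)) = setT -> bounded_op A ->
  forall x y, inner (A x) y = inner x (adjoint A y).
Proof. by move=> hg tg; exact: adjoint_exists (enum_family_qon hg) (enum_family_total tg). Qed.

Lemma isometric_on_basis (G : hilbertType R) (A : H -> G) :
  quasi_orthonormal predT g -> closure (lspan (range g)) = setT -> bounded_op A ->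
  (forall v w, inner (A (g v)) (A (g w)) = (v == w)%:R) ->
  forall x, rnorm (A x) = rnorm x.
Proof.
move=> hg tg bA hA x; have aA := op_adj_basis hg tg bA.
have iA : adjoint A \o A = id.
  apply: (op_eq_basis tg); [exact: (comp_bounded (adjoint_bounded bA aA) bA)|exact: id_bounded|].
  by move=> v; apply: (basis_eq tg) => w /=; rewrite innerC -aA -innerC hA hg andbT.
have iAx : adjoint A (A x) = x := congr1 (fun f => f x) iA.
have : inner (A x) (A x) = inner x x by rewrite aA iAx.
by rewrite !innerxx => -[] /eqP; rewrite eqrXn2 ?rnorm_ge0 // => /eqP.
Qed.
End CountableBasis.

(** * The basis of a full Fock space *)

Section FockSpace.
Variables (R : realType) (H : hilbertType R) (m : nat) (e : 'I_m -> H).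
Variable F : fock_space H.
Hypothesis e_basis : orthonormal_basis setT e setT.
Local Notation C := R[i].
Local Notation fv := (fun a : seq 'I_m => fock_pure (map e a) : F).

Lemma fock_vec_orthonormal : quasi_orthonormal predT fv.
Proof.
have [ee _] := e_basis.
move=> a b; rewrite fock_pure_inner !size_map andbT.
elim: a b => [|i a IH] [|j b] //=; first by rewrite big_nil.
rewrite eqSS big_cons /= eqseq_cons ee //; have := IH b.
case: (i == j); rewrite ?mul1r ?mul0r //= => _.
by case: ifP.
Qed.

(** Elementary tensors are only known through their inner products. These are
    linear in each entry and determine a vector, hence the elementary tensor
    is linear in each entry; they also give its norm, hence continuity. *)
Lemma fock_slot (s t : seq H) : bounded_op (fun x : H => fock_pure (s ++ x :: t) : F).
Proof.
have key (z : seq H) : exists c u, forall x : H,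
    inner (fock_pure (s ++ x :: t) : F) (fock_pure z) = c * inner x u.
  have [sz|sz] := eqVneq (size z) (size s + (size t).+1)%N; last first.
    exists 0, 0 => x; rewrite fock_pure_inner size_cat /= eq_sym (negbTE sz).
    by rewrite mul0r.
  have hz : z = take (size s) z ++ drop (size s) z by rewrite cat_take_drop.
  have : size (drop (size s) z) = (size t).+1 by rewrite size_drop sz addKn.
  have s1 : size (take (size s) z) = size s by rewrite size_takel // sz leq_addr.
  case: (drop (size s) z) hz => // u z2 hz [s2].
  exists (\prod_(p <- zip s (take (size s) z)) inner p.1 p.2 *
          \prod_(p <- zip t z2) inner p.1 p.2), u => x.
  rewrite fock_pure_inner size_cat /= sz eqxx {1}hz zip_cat // big_cat /= big_cons /=.
  by rewrite mulrCA mulrC.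
have lin : linear (fun x : H => fock_pure (s ++ x :: t) : F).
  move=> a x y; apply/eqP; rewrite -subr_eq0; apply/eqP.
  apply: (total_orth0 (@fock_pure_total _ _ F)) => _ [z _ <-]; apply: inner_eq0C.
  have [c [u h]] := key z.
  by rewrite innerBl innerDl innerZl !h innerDl innerZl mulrDr mulrCA subrr.
pose k : C := \prod_(p <- zip s s) inner p.1 p.2 * \prod_(p <- zip t t) inner p.1 p.2.
apply: (@bounded_opI _ _ _ _ (Num.sqrt (rnorm k))) => // x.
rewrite -(@ler_pXn2r _ 2) ?nnegrE ?mulr_ge0 ?sqrtr_ge0 ?rnorm_ge0 //.
rewrite exprMn sqr_sqrtr ?rnorm_ge0 //.
have e1 : inner (fock_pure (s ++ x :: t) : F) (fock_pure (s ++ x :: t)) = k * inner x x.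
  rewrite fock_pure_inner eqxx zip_cat // big_cat /= big_cons /= /k.
  by rewrite mulrCA mulrC.
have := congr1 (@rnorm R C) e1; rewrite rnormM !innerxx !rnorm_realC !ger0_norm ?exprn_ge0 ?rnorm_ge0 // => ->.
by [].
Qed.

(** The arbitrary entries of an elementary tensor are replaced by basis
    vectors one at a time, starting from the right. *)
Lemma fock_vec_total : closure (lspan (range fv)) = setT.
Proof.
have [_ te] := e_basis.
apply: total_of_orth0 => y hy.
apply: (total_orth0 (@fock_pure_total _ _ F)) => _ [s _ <-].
suff h : forall a, inner (fock_pure (s ++ map e a) : F) y = 0.
  by have := h [::]; rewrite cats0.
elim/last_ind: s => [|s x IH] a; first by apply: hy; exists a.
rewrite cat_rcons; move: x.
apply: (total_ind te (subspace_preim (fock_slot s (map e a)) (subspace_orth y))) => _ [j _ <-].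
exact: (IH (j :: a)).
Qed.

Variables (sg : seq 'I_m -> seq 'I_m) (tau : seq 'I_m -> option (seq 'I_m)).
Hypothesis tauK : pcancel sg tau.
Hypothesis sgK : ocancel tau sg.

Lemma word_shift_exists : exists A : F -> F, bounded_op A /\ forall a, A (fv a) = fv (sg a).
Proof.
apply: (extend_contraction (dd := predT) fock_vec_orthonormal fock_vec_total) => a b.
rewrite (fock_vec_orthonormal (sg a) (sg b)) !andbT; congr (nat_of_bool _)%:R.
by apply/eqP/eqP => [/(pcan_inj tauK)|->].
Qed.

(** The adjoint of the operator induced by sg is the operator induced by its
    partial inverse tau, which kills the words outside the range of sg. *)
Lemma word_shift_coef (A : F -> F) : bounded_op A -> (forall a, A (fv a) = fv (sg a)) ->
  forall x b, inner (A x) (fv b) = oapp (fun a => inner x (fv a)) 0 (tau b).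
Proof.
move=> bA hA x b.
have -> : oapp (fun a => inner x (fv a)) 0 (tau b) = inner x (oapp fv 0 (tau b)).
  by case: (tau b) => //=; rewrite inner0r.
move: x; apply: (total_ind fock_vec_total (subspace_adj _ _ bA)) => _ [a _ <-] /=.
rewrite hA (fock_vec_orthonormal (sg a) b) andbT.
have := sgK b; case E : (tau b) => [a'|] /=; last first.
  move=> _; rewrite inner0r; case: eqP => // ab; move: E; rewrite -ab tauK //.
move=> <-; rewrite (fock_vec_orthonormal a a') andbT; congr (nat_of_bool _)%:R.
by apply/eqP/eqP => [/(pcan_inj tauK)|->].
Qed.
End FockSpace.

(** * The basis of the tensor product and the creation operators *)

Section Tensor.
Variables (R : realType) (k : nat) (n : 'I_k -> nat).
Variables (H : 'I_k -> hilbertType R) (e : forall i, 'I_(n i) -> H i).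
Variable F : forall i, fock_space (H i).
Variable T : hilbert_tensor (fun i => F i : hilbertType R).
Hypothesis e_basis : forall i, orthonormal_basis setT (@e i) setT.
Local Notation C := R[i].
Local Notation mword := {dffun forall i : 'I_k, seq 'I_(n i)}.
Local Notation tp := (@tensor_pure R k (fun i => F i : hilbertType R) T).
Local Notation fv i := (fun a => fock_vec e F (i := i) a).
Local Notation vec := (vec e T).

(** As for Fock spaces, linearity in one factor follows from the inner
    products of elementary tensors. *)
Lemma tensor_slot (x : forall i, F i) i :
  bounded_op (fun u : F i => tp (dfwith x i u)).
Proof.
have key (z : forall i, F i) : exists c, forall u,
    inner (tp (dfwith x i u)) (tp z) = c * inner u (z i).
  exists (\prod_(j | j != i) inner (x j) (z j)) => u.
  rewrite tensor_pure_inner (bigD1 i) //= dfwithin mulrC; congr (_ * _).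
  by apply: eq_bigr => j ji; rewrite dfwithout // eq_sym.
have lin : linear (fun u : F i => tp (dfwith x i u)).
  move=> a u v; apply/eqP; rewrite -subr_eq0; apply/eqP.
  apply: (total_orth0 (@tensor_pure_total _ _ _ T)) => _ [z _ <-]; apply: inner_eq0C.
  have [c h] := key z.
  by rewrite innerBl innerDl innerZl !h innerDl innerZl mulrDr mulrCA subrr.
pose c : C := \prod_(j | j != i) inner (x j) (x j).
apply: (@bounded_opI _ _ _ _ (Num.sqrt (rnorm c))) => // u.
rewrite -(@ler_pXn2r _ 2) ?nnegrE ?mulr_ge0 ?sqrtr_ge0 ?rnorm_ge0 //.
rewrite exprMn sqr_sqrtr ?rnorm_ge0 //.
have e1 : inner (tp (dfwith x i u)) (tp (dfwith x i u)) = c * inner u u.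
  rewrite tensor_pure_inner (bigD1 i) //= dfwithin mulrC; congr (_ * _).
  by apply: eq_bigr => j ji; rewrite dfwithout // eq_sym.
have := congr1 (@rnorm R C) e1; rewrite rnormM !innerxx !rnorm_realC !ger0_norm ?exprn_ge0 ?rnorm_ge0 // => ->.
by [].
Qed.

Lemma vec_inner_pure (x : forall i, F i) (w : mword) :
  inner (tp x) (vec w) = \prod_i inner (x i) (fv i (w i)).
Proof. by rewrite tensor_pure_inner. Qed.

Lemma vec_orthonormal : quasi_orthonormal (I := mword) predT vec.
Proof.
move=> w v; rewrite vec_inner_pure andbT.
have [<-|wv] := eqVneq w v.
  rewrite big1 // => i _.
  by have := fock_vec_orthonormal (F i) (e_basis i) (w i) (w i); rewrite eqxx.
have [i wvi] : exists i, w i != v i.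
  apply/existsP; rewrite -negb_forall; apply: contra wv => /forallP h.
  by apply/eqP/ffunP => i; apply/eqP.
rewrite (bigD1 i) //=.
by have := fock_vec_orthonormal (F i) (e_basis i) (w i) (v i); rewrite (negbTE wvi) => ->; rewrite mul0r.
Qed.

(** The factors of an elementary tensor are replaced by basis vectors one at a
    time, by induction on the number m of arbitrary factors. *)
Lemma vec_total : closure (lspan (range vec)) = setT.
Proof.
apply: total_of_orth0 => y hy.
apply: (total_orth0 (@tensor_pure_total _ _ _ T)) => _ [x _ <-].
suff key : forall m (x : forall i, F i),
    (forall i : 'I_k, (m <= i)%N -> exists a, x i = fv i a) -> inner (tp x) y = 0.
  by apply: (key k) => i; rewrite leqNgt ltn_ord.
move=> {x}; elim=> [|m IH] x hx.
  have hx' i : {a | x i = fv i a} by apply: cid; exact: hx.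
  pose w : mword := [ffun i => projT1 (hx' i)].
  have <- : vec w = tp x.
    congr tp; apply: functional_extensionality_dep => i.
    by rewrite ffunE; case: (hx' i) => a /= ->.
  by apply: hy; exists w.
have [mk|km] := ltnP m k; last first.
  by apply: IH => i mi; apply: hx; have := ltn_ord i; lia.
pose i : 'I_k := Ordinal mk.
have -> : tp x = tp (dfwith x i (x i)).
  congr tp; apply: functional_extensionality_dep => j.
  by case: dfwithP.
move: (x i) => u; move: u.
apply: (total_ind (fock_vec_total (F i) (e_basis i)) (subspace_preim (tensor_slot x i) (subspace_orth y))) => _ [a _ <-].
apply: IH => j; case: dfwithP => [_|j' ij' mj]; first by exists a.
apply: hx; rewrite ltn_neqAle mj andbT; apply: contra ij' => /eqP h.
by apply/eqP/val_inj.
Qed.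

Definition upd (w : mword) i (a : seq 'I_(n i)) : mword := finfun (dfwith w i a).

Lemma upd_in w i a : upd w a i = a :> seq 'I_(n i).
Proof. by rewrite ffunE dfwithin. Qed.
Lemma upd_out w i (a : seq 'I_(n i)) j : i != j -> upd w a j = w j.
Proof. by move=> ij; rewrite ffunE dfwithout. Qed.

Lemma tp_vec_upd (w : mword) i (a : seq 'I_(n i)) :
  tp (dfwith (fun j => fv j (w j)) i (fv i a)) = vec (upd w a).
Proof.
congr tp; apply: functional_extensionality_dep => j.
case: dfwithP => [|j' ij]; first by rewrite upd_in.
by rewrite upd_out.
Qed.

Section Shift.
Variables (i : 'I_k).
Variables (sg : seq 'I_(n i) -> seq 'I_(n i)) (tau : seq 'I_(n i) -> option (seq 'I_(n i))).
Hypothesis tauK : pcancel sg tau.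
Hypothesis sgK : ocancel tau sg.

(** The shift B of basis vectors is an isometry, but the ampliation is
    characterized on all elementary tensors. Both sides of that
    characterization have the same inner products with the basis, as the
    adjoint B' of B shows. *)
Lemma ampliation_shift (A : F i -> F i) :
  bounded_op A -> (forall a, A (fv i a) = fv i (sg a)) ->
  bounded_op (ampliation (T := T) A) /\
  forall w, ampliation (T := T) A (vec w) = vec (upd w (sg (w i))).
Proof.
move=> bA hA.
have [B [bB hB]] : exists B : T -> T, bounded_op B /\ forall w, B (vec w) = vec (upd w (sg (w i))).
  apply: (extend_contraction (dd := predT) vec_orthonormal vec_total) => w v.
  rewrite vec_orthonormal !andbT; congr (nat_of_bool _)%:R.
  apply/eqP/eqP => [h|->//]; apply/ffunP => j.
  have := congr1 (fun w : mword => w j) h.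
  have [<-|ij] := eqVneq i j; last by rewrite !upd_out.
  by rewrite !upd_in => /(pcan_inj tauK).
have [B' [bB' hB']] : exists B' : T -> T, bounded_op B' /\
    forall v, B' (vec v) = oapp (fun a => vec (upd v a)) 0 (tau (v i)).
  apply: (extend_contraction (dd := fun v : mword => isSome (tau (v i))) vec_orthonormal vec_total) => v w.
  have := sgK (v i); have := sgK (w i).
  case Ev : (tau (v i)) => [a|]; case Ew : (tau (w i)) => [b|] /=; rewrite ?inner0l ?inner0r ?andbF //.
    move=> hw hv; rewrite vec_orthonormal !andbT; congr (nat_of_bool _)%:R.
    apply/eqP/eqP => h.
      apply/ffunP => j; have := congr1 (fun w : mword => w j) h.
      have [<-|ij] := eqVneq i j; last by rewrite !upd_out.
      by rewrite !upd_in -hv -hw => ->.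
    by move: Ev Ew; rewrite h => -> [] ->.
  move=> _ _; case: eqP => // h; move: Ev Ew; rewrite h => ->; by [].
have adjB x y : inner (B x) y = inner x (B' y).
  apply: (adj_total bB bB' vec_total vec_total) => _ _ [w _ <-] [v _ <-].
  rewrite hB hB' vec_orthonormal andbT; have := sgK (v i).
  case Ev : (tau (v i)) => [a|] /= hv.
    rewrite vec_orthonormal andbT; congr (nat_of_bool _)%:R; apply/eqP/eqP => h; apply/ffunP => j.
      have [<-|ij] := eqVneq i j; last by rewrite -h !upd_out.
      by rewrite upd_in; apply: (pcan_inj tauK); rewrite hv -h upd_in.
    have [<-|ij] := eqVneq i j; last by rewrite upd_out // h upd_out.
    by rewrite upd_in h upd_in hv.
  rewrite inner0r; case: eqP => // h; move: Ev; rewrite -h upd_in tauK; by [].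
suff PB : forall x : forall i', F i', B (tp x) = tp (dfwith x i (A (x i))).
  have [bC PC] := @bounded_op_such_thatP _ _ _ (fun B => forall x : forall i', F i',
     B (tp x) = tp (dfwith x i (A (x i)))) (ex_intro _ B (conj bB PB)).
  split=> // w; rewrite /ampliation {1}/Defs.vec PC hA tp_vec_upd //.
move=> x; apply: (basis_eq vec_total) => v.
rewrite adjB hB' vec_inner_pure (bigD1 i) //= dfwithin.
rewrite (word_shift_coef (e_basis i) tauK sgK bA hA).
case: (tau (v i)) => [a|] /=; last by rewrite inner0r mul0r.
rewrite vec_inner_pure (bigD1 i) //= upd_in; congr (_ * _).
by apply: eq_bigr => j ji; rewrite upd_out ?dfwithout // eq_sym.
Qed.
End Shift.

Lemma opS_spec i (j : 'I_(n i)) :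
  bounded_op (opS e (T := T) j) /\ forall w : mword, opS e (T := T) j (vec w) = vec (upd w (j :: w i)).
Proof.
pose sg := cons j; pose tau (b : seq 'I_(n i)) := if b is j' :: a then if j' == j then Some a else None else None.
have tauK : pcancel sg tau by move=> a; rewrite /= eqxx.
have sgK : ocancel tau sg by case=> //= j' a; case: eqP => //= ->.
have [bA hA] := @bounded_op_such_thatP _ _ _ (fun A => forall a, A (fv i a) = fv i (j :: a))
  (word_shift_exists (F i) (e_basis i) tauK).
exact: (ampliation_shift tauK sgK bA hA).
Qed.

Lemma opR_spec i (j : 'I_(n i)) :
  bounded_op (opR e (T := T) j) /\ forall w : mword, opR e (T := T) j (vec w) = vec (upd w (rcons (w i) j)).
Proof.
pose sg := rcons^~ j; pose tau (b : seq 'I_(n i)) :=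
  if rev b is j' :: a then if j' == j then Some (rev a) else None else None.
have tauK : pcancel sg tau by move=> a; rewrite /tau /sg rev_rcons eqxx revK.
have sgK : ocancel tau sg.
  move=> b; have := revK b; rewrite /tau; case: (rev b) => [|j' a] //= hb.
  by case: eqP => //= ej; rewrite /sg -hb rev_cons ej.
have [bA hA] := @bounded_op_such_thatP _ _ _ (fun A => forall a, A (fv i a) = fv i (rcons a j))
  (word_shift_exists (F i) (e_basis i) tauK).
exact: (ampliation_shift tauK sgK bA hA).
Qed.
End Tensor.

(** * Left translations and the telescoping of the defect map *)

Section Model.
Variables (R : realType) (k : nat) (n : 'I_k -> nat).
Variables (H : 'I_k -> hilbertType R) (e : forall i, 'I_(n i) -> H i).
Variable F : forall i, fock_space (H i).
Variable T : hilbert_tensor (fun i => F i : hilbertType R).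
Hypothesis e_basis : forall i, orthonormal_basis setT (@e i) setT.
Local Notation C := R[i].
Local Notation mword := {dffun forall i : 'I_k, seq 'I_(n i)}.
Local Notation vec := (vec e T).
Let vq := vec_orthonormal T e_basis.
Let vt := vec_total T e_basis.

Definition mcat (w v : mword) : mword := finfun (fun i => w i ++ v i).
Definition mnil : mword := finfun (fun i => [::]).
Definition mgen i (j : 'I_(n i)) : mword := upd mnil [:: j].
Definition mdrop (w v : mword) : mword := finfun (fun i => drop (size (w i)) (v i)).

Lemma mcatE w v i : mcat w v i = w i ++ v i. Proof. exact: ffunE. Qed.
Lemma mnilE i : mnil i = [::] :> seq 'I_(n i). Proof. exact: ffunE. Qed.
Lemma mdropE w v i : mdrop w v i = drop (size (w i)) (v i). Proof. exact: ffunE. Qed.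

Lemma mcatA u v w : mcat u (mcat v w) = mcat (mcat u v) w.
Proof. by apply/ffunP => i; rewrite !mcatE catA. Qed.
Lemma mcat0w w : mcat mnil w = w.
Proof. by apply/ffunP => i; rewrite mcatE mnilE. Qed.
Lemma mcatI w : injective (mcat w).
Proof.
move=> u v /(congr1 (fun x : mword => x : forall i, _)) h; apply/ffunP => i.
have := congr1 (fun f : forall i, seq 'I_(n i) => f i) h.
by rewrite /= !mcatE => /eqP; rewrite eqseq_cat // eqxx /= => /eqP.
Qed.
Lemma mdropK w v : mdrop w (mcat w v) = v.
Proof. by apply/ffunP => i; rewrite mdropE mcatE drop_size_cat. Qed.
Lemma mcat_gen i (j : 'I_(n i)) w : mcat (mgen j) w = upd w (j :: w i).
Proof.
apply/ffunP => i'; rewrite mcatE; have [<-|ii] := eqVneq i i'.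
  by rewrite !upd_in.
by rewrite !upd_out // mnilE.
Qed.
Lemma mcat_upd0 (w : mword) i (a : seq 'I_(n i)) : w i = [::] -> mcat w (upd mnil a) = upd w a.
Proof.
move=> wi; apply/ffunP => i'; rewrite mcatE; have [<-|ii] := eqVneq i i'.
  by rewrite !upd_in wi.
by rewrite !upd_out // mnilE cats0.
Qed.
Lemma upd_id (w : mword) i : upd w (w i) = w.
Proof.
apply/ffunP => j; have [<-|ij] := eqVneq i j; first by rewrite upd_in.
by rewrite upd_out.
Qed.

(** Every multiword is a product of generators. *)
Lemma mword_ind (Q : mword -> Prop) : Q mnil ->
  (forall i (j : 'I_(n i)) w, Q w -> Q (mcat (mgen j) w)) -> forall w, Q w.
Proof.
move=> Q0 QS w; have [m] := ubnP (\sum_i size (w i)); elim: m w => // m IH w hm.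
have [h|/forallPn [i wi]] := boolP [forall i, w i == [::]].
  suff -> : w = mnil by [].
  by apply/ffunP => i; rewrite mnilE; apply/eqP; exact: (forallP h).
case E : (w i) wi => [//|j a] _.
have -> : w = mcat (mgen j) (upd w a).
  rewrite mcat_gen upd_in; apply/ffunP => i'; have [<-|ii] := eqVneq i i'.
    by rewrite upd_in.
  by rewrite !upd_out.
apply: QS; apply: IH.
suff h : (\sum_i size (w i) = (\sum_i size (upd w a i)).+1)%N by rewrite h in hm.
rewrite [LHS](bigD1 i) // [in RHS](bigD1 i) //= E upd_in /=; congr (_ + _).+1.
by apply: eq_bigr => i' ii; rewrite upd_out // eq_sym.
Qed.

Lemma mcat_gen_neq0 i (j : 'I_(n i)) w : mcat (mgen j) w != mnil.
Proof.
by apply/eqP => /(congr1 (fun x : mword => x i)); rewrite mcat_gen upd_in mnilE.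
Qed.

(** The product S_{1,w_1} ... S_{k,w_k}. Its definition by the action on basis
    vectors does not depend on the order of the k commuting factors. *)
Definition left_op (w : mword) : T -> T :=
  bounded_op_such_that (fun A => forall v : mword, A (vec v) = vec (mcat w v)).
Local Notation L := left_op.

Lemma left_op_spec w : bounded_op (L w) /\ forall v : mword, L w (vec v) = vec (mcat w v).
Proof.
apply: bounded_op_such_thatP; apply: (extend_contraction (dd := predT) vq vt) => u v.
by rewrite (vq (mcat w u) (mcat w v)) (inj_eq (@mcatI w)).
Qed.
Lemma left_op_bounded w : bounded_op (L w). Proof. by case: (left_op_spec w). Qed.
Lemma left_op_vec w v : L w (vec v) = vec (mcat w v). Proof. by case: (left_op_spec w). Qed.

Definition left_adj w := adjoint (L w).
Local Notation Ls := left_adj.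
Lemma left_op_adjoint w x y : inner (L w x) y = inner x (Ls w y).
Proof. exact: (op_adj_basis vq vt (left_op_bounded w)). Qed.
Lemma left_adj_adjoint w x y : inner (Ls w x) y = inner x (L w y).
Proof. by rewrite innerC -left_op_adjoint -innerC. Qed.
Lemma left_adj_bounded w : bounded_op (Ls w).
Proof. exact: (adjoint_bounded (left_op_bounded w) (left_op_adjoint w)). Qed.

Lemma left_op0 w : L w 0 = 0. Proof. by rewrite (lin0 (left_op_bounded w).1). Qed.
Lemma left_adj_vec w v : Ls w (vec (mcat w v)) = vec v.
Proof.
apply: (basis_eq vt) => u.
by rewrite left_adj_adjoint left_op_vec vq (inj_eq (@mcatI w)) (vq v u).
Qed.

(** A multiword v which does not start with w is orthogonal to the range of
    S_w. *)
Lemma left_adj_vec0 w v : v != mcat w (mdrop w v) -> Ls w (vec v) = 0.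
Proof.
move=> h; apply: (basis_eq vt) => u; rewrite inner0l.
rewrite left_adj_adjoint left_op_vec vq; case: eqP => // hv.
by move: h; rewrite hv mdropK eqxx.
Qed.

Lemma left_adjK w x : Ls w (L w x) = x.
Proof.
have h : Ls w \o L w = id.
  apply: (op_eq_basis vt); [exact: (comp_bounded (left_adj_bounded w) (left_op_bounded w))|exact: id_bounded|].
  by move=> v; rewrite /= left_op_vec left_adj_vec.
exact: (congr1 (fun f => f x) h).
Qed.

Lemma left_op_inner w x y : inner (L w x) (L w y) = inner x y.
Proof. by rewrite left_op_adjoint left_adjK. Qed.

Lemma left_op_rnorm w x : rnorm (L w x) = rnorm x.
Proof.
have := left_op_inner w x x; rewrite !innerxx => -[] /eqP.
by rewrite eqrXn2 ?rnorm_ge0 // => /eqP.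
Qed.

Lemma left_op_mcat w v x : L (mcat w v) x = L w (L v x).
Proof.
have h : L (mcat w v) = L w \o L v.
  apply: (op_eq_basis vt); [exact: left_op_bounded|exact: (comp_bounded (left_op_bounded w) (left_op_bounded v))|].
  by move=> u; rewrite /= !left_op_vec mcatA.
by rewrite h.
Qed.

Lemma left_adj_mcat w v x : Ls (mcat w v) x = Ls v (Ls w x).
Proof.
have h y : inner (Ls (mcat w v) x) y = inner (Ls v (Ls w x)) y.
  by rewrite !left_adj_adjoint left_op_mcat.
by apply: (basis_eq vt) => u; exact: h.
Qed.

Lemma left_op_nil x : L mnil x = x.
Proof.
have h : L mnil = id.
  apply: (op_eq_basis vt); [exact: left_op_bounded|exact: id_bounded|].
  by move=> u; rewrite left_op_vec mcat0w.
by rewrite h.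
Qed.

Lemma left_adj_nil x : Ls mnil x = x.
Proof. by apply: (basis_eq vt) => u; rewrite left_adj_adjoint left_op_nil. Qed.

Lemma opS_L i (j : 'I_(n i)) : opS e (T := T) j = L (mgen j).
Proof.
have [bS hS] := opS_spec T e_basis j.
by apply: (op_eq_basis vt bS (left_op_bounded _)) => w; rewrite hS left_op_vec mcat_gen.
Qed.

Lemma opR_wordP i (a : seq 'I_(n i)) :
  bounded_op (opR_word e (T := T) a) /\
  forall w : mword, opR_word e (T := T) a (vec w) = vec (upd w (w i ++ rev a)).
Proof.
elim: a => [|j a [bA hA]].
  split; first exact: id_bounded.
  by move=> w; rewrite /= cats0 upd_id.
have [bR hR] := opR_spec T e_basis j.
split; first exact: (comp_bounded bR bA).
move=> w; rewrite /= hA hR; congr vec; apply/ffunP => i'.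
have [<-|ii] := eqVneq i i'; last by rewrite !(upd_out _ _ ii).
by rewrite !upd_in rev_cons rcons_cat.
Qed.

(** Right multiplication by the letters of a word appends them in reverse
    order, so that the word itself is appended when it is reversed first. *)
Lemma opR_revP (w : mword) :
  bounded_op (opR_rev e (T := T) w) /\
  forall v : mword, opR_rev e (T := T) w (vec v) = vec (mcat v w).
Proof.
suff h (l : seq 'I_k) : uniq l ->
    bounded_op (foldr (fun i B => opR_word e (rev (w i)) \o B) id l : T -> T) /\
    forall v : mword, foldr (fun i B => opR_word e (rev (w i)) \o B) id l (vec v) =
      vec (finfun (fun i => v i ++ (if i \in l then w i else [::]))).
  have [b hb] := h _ (enum_uniq 'I_k); split=> [|v]; first exact: b.
  apply: (etrans (hb v)); congr vec; by apply/ffunP => i; rewrite ffunE mem_enum mcatE.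
elim: l => [_|i l IH /= /andP[il /IH [b hb]]].
  split; first exact: id_bounded.
  by move=> v /=; congr vec; apply/ffunP => i; rewrite ffunE cats0.
have [bR hR] := opR_wordP (rev (w i)).
split; first exact: (comp_bounded bR b).
move=> v; rewrite /= hb hR revK; congr vec; apply/ffunP => i'.
rewrite [RHS]ffunE in_cons; have [<-|ii] := eqVneq i i'.
  by rewrite upd_in ffunE (negbTE il) cats0.
by rewrite upd_out // ffunE.
Qed.

Lemma PhiE i (Y : T -> T) x :
  Phi e i Y x = \sum_(j < n i) L (mgen j) (Y (Ls (mgen j) x)).
Proof. by apply: eq_bigr => j _; rewrite opS_L. Qed.

(** The composition of the maps id - Phi_i over part of the indices, for
    inductions over the indices. *)
Definition partial_defect (l : seq 'I_k) (Y : T -> T) : T -> T :=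
  foldr (fun i Y x => Y x - Phi e i Y x) Y l.

Lemma defectE (M : set T) : defect e M = partial_defect (enum 'I_k) (orth_proj M).
Proof. by []. Qed.

Lemma partial_defect_cons i l Y x : partial_defect (i :: l) Y x =
  partial_defect l Y x - \sum_(j < n i) L (mgen j) (partial_defect l Y (Ls (mgen j) x)).
Proof. by rewrite /= PhiE. Qed.

Lemma partial_defect_bounded l Y : bounded_op Y -> bounded_op (partial_defect l Y).
Proof.
move=> bY; elim: l => //= i l IH; apply: (sub_bounded IH).
rewrite (_ : Phi e i _ = fun x => \sum_(j < n i) L (mgen j) (partial_defect l Y (Ls (mgen j) x))).
  apply: sum_bounded => j.
  exact: (comp_bounded (left_op_bounded _) (comp_bounded IH (left_adj_bounded _))).
by apply/funext => x; rewrite PhiE.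
Qed.

Lemma partial_defect_sa l Y : (forall x y, inner (Y x) y = inner x (Y y)) ->
  forall x y, inner (partial_defect l Y x) y = inner x (partial_defect l Y y).
Proof.
move=> hY; elim: l => // i l IH x y.
rewrite !partial_defect_cons innerBl innerBr IH; congr (_ - _).
rewrite inner_suml inner_sumr; apply: eq_bigr => j _.
by rewrite left_op_adjoint IH left_adj_adjoint.
Qed.

Lemma partial_defect_in l Y (M : set T) : closed_subspace M -> S_invariant e M ->
  (forall x, M (Y x)) -> forall x, M (partial_defect l Y x).
Proof.
move=> hM SM hY; elim: l => // i l IH x; rewrite partial_defect_cons.
apply: subspaceB => //; apply: subspace_sum => // j _ _; rewrite -opS_L; exact: SM.
Qed.

(** The maps id - Phi_i involve only the operators S and S^*, with which A and
    B commute respectively. *)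
Lemma partial_defect_comm l (A : T -> T) (B : T -> T) Y : linear A ->
  (forall w x, A (L w x) = L w (A x)) -> (forall w x, B (Ls w x) = Ls w (B x)) ->
  forall x, partial_defect l (fun x => A (Y (B x))) x = A (partial_defect l Y (B x)).
Proof.
move=> lA hA hB; elim: l => // i l IH x.
rewrite !partial_defect_cons IH (linB lA) (linear_bigsum lA); congr (_ - _).
by apply: eq_bigr => j _; rewrite IH hA hB.
Qed.

Lemma partial_defect_sum l (I : Type) (r : seq I) (Y : I -> T -> T) x :
  partial_defect l (fun x => \sum_(s <- r) Y s x) x = \sum_(s <- r) partial_defect l (Y s) x.
Proof.
elim: l x => // i l IH x; rewrite partial_defect_cons.
under [RHS]eq_bigr do rewrite partial_defect_cons.
rewrite IH sumrB; congr (_ - _); rewrite exchange_big /=.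
by apply: eq_bigr => j _; rewrite IH (linear_bigsum (left_op_bounded _).1).
Qed.

Lemma partial_defect_cvg l (Y : nat -> T -> T) Z :
  (forall x, (fun m => Y m x) @ \oo --> Z x) ->
  forall x, (fun m => partial_defect l (Y m) x) @ \oo --> partial_defect l Z x.
Proof.
move=> hY; elim: l => // i l IH x.
rewrite partial_defect_cons.
rewrite (_ : (fun m => _) = (fun m => partial_defect l (Y m) x) \-
  (fun m => \sum_(j < n i) L (mgen j) (partial_defect l (Y m) (Ls (mgen j) x)))); last first.
  by apply/funext => m; rewrite partial_defect_cons.
apply: cvgB; first exact: IH.
by apply: cvg_nat_sum => j; exact: (op_cvg (left_op_bounded _) (IH _)).
Qed.

(** (id - Phi_i)(I) is the projection onto the span of the basis vectors whose
    i-th word is empty. *)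
Lemma partial_defect_id l : uniq l -> forall v : mword,
  partial_defect l id (vec v) = if [forall (i | i \in l), v i == [::]] then vec v else 0.
Proof.
elim: l => [_ v|i l IH]; last rewrite cons_uniq => /andP[il ul] v.
  by case: ifP => // /forallP [] i.
have bl := partial_defect_bounded l (@id_bounded R T).
rewrite partial_defect_cons !IH //.
case Ev : (v i) => [|j a].
  rewrite big1 ?subr0 => [|j _]; last first.
    rewrite left_adj_vec0 ?(lin0 bl.1) ?left_op0 //.
    apply/eqP => /(congr1 (fun x : mword => x i)); by rewrite mcat_gen upd_in Ev.
  congr (if _ then _ else _); apply: eq_forallb => i'; rewrite in_cons.
  by have [->|//] := eqVneq i' i; rewrite (negbTE il) /= Ev eqxx.
rewrite (bigD1 j) //= big1 ?addr0 => [|j' jj]; last first.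
  rewrite left_adj_vec0 ?(lin0 bl.1) ?left_op0 //.
  apply/eqP => /(congr1 (fun x : mword => x i)); rewrite mcat_gen upd_in Ev => -[] e1.
  by move: jj; rewrite e1 eqxx.
have hv : v = mcat (mgen j) (upd v a).
  rewrite mcat_gen upd_in; apply/ffunP => i'; have [<-|ii] := eqVneq i i'.
    by rewrite upd_in.
  by rewrite !upd_out.
rewrite {3}hv left_adj_vec IH //.
have -> : [forall (i0 | i0 \in l), upd v a i0 == [::]] = [forall (i0 | i0 \in l), v i0 == [::]].
  apply: eq_forallb => i'; have [<-|ii] := eqVneq i i'; first by rewrite (negbTE il).
  by rewrite upd_out.
have -> : [forall (i0 | i0 \in i :: l), v i0 == [::]] = false.
  by apply/negbTE/forallPn; exists i; rewrite mem_head Ev.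
by case: ifP; rewrite ?left_op0 ?subrr // left_op_vec -hv subrr.
Qed.

Lemma defect_id x : partial_defect (enum 'I_k) id x = inner x (vec mnil) *: vec mnil.
Proof.
have bl := partial_defect_bounded (enum 'I_k) (@id_bounded R T).
have h : partial_defect (enum 'I_k) id = fun x => inner x (vec mnil) *: vec mnil.
  apply: (op_eq_basis vt bl).
    apply: (@bounded_opI _ _ _ _ 1) => [a u v|u].
      by rewrite innerDl innerZl scalerDl scalerA.
    rewrite rnormZ mul1r; apply: (le_trans (ler_wpM2r (rnorm_ge0 _) (cauchy_schwarz _ _))).
    have -> : rnorm (vec mnil) = 1.
      have := vq mnil mnil; rewrite eqxx innerxx => -[] /eqP.
      by rewrite sqrp_eq1 ?rnorm_ge0 // => /eqP.
    by rewrite !mulr1.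
  move=> v; rewrite partial_defect_id ?enum_uniq // vq andbT.
  case: (eqVneq v mnil) => [->|vn].
    by rewrite scale1r; case: ifP => // /negP []; apply/forallP => i; rewrite mnilE eqxx implybT.
  rewrite scale0r; case: ifP => // /forallP h.
  case/negP: vn; apply/eqP/ffunP => i; rewrite mnilE; apply/eqP.
  by have := h i; rewrite mem_enum.
by rewrite h.
Qed.

(** The equation Y = Z + Phi_i(Y) is iterated along the i-th word, one letter
    at a time. The iteration stops because Phi_i(Y) kills the basis vectors
    with empty i-th word, so that Y is the sum of the Phi_i^t(Z), which is
    finite on each basis vector. *)
Lemma telescope_letter i (Y Z : T -> T) : Y 0 = 0 ->
  (forall x, Z x = Y x - \sum_(j < n i) L (mgen j) (Y (Ls (mgen j) x))) ->
  forall (a : seq 'I_(n i)) (v : mword), Y (vec (upd v a)) =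
  \sum_(t <- iota 0 (size a).+1) L (upd mnil (take t a)) (Z (vec (upd v (drop t a)))).
Proof.
move=> Y0 hZ; elim=> [|j a IH] v.
  rewrite big_seq1 /= hZ.
  have -> : upd mnil ([::] : seq 'I_(n i)) = mnil by rewrite -[in LHS](mnilE i) upd_id.
  rewrite left_op_nil big1 ?subr0 // => j _.
  rewrite left_adj_vec0 ?Y0 ?left_op0 //.
  by apply/eqP => /(congr1 (fun x : mword => x i)); rewrite mcat_gen !upd_in.
rewrite [size _]/= [iota 0 _]/= big_cons take0 drop0.
have -> : upd mnil ([::] : seq 'I_(n i)) = mnil by rewrite -[in LHS](mnilE i) upd_id.
rewrite left_op_nil hZ (bigD1 j) //= big1 ?addr0 => [|j' jj]; last first.
  rewrite left_adj_vec0 ?Y0 ?left_op0 //.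
  apply/eqP => /(congr1 (fun x : mword => x i)); rewrite mcat_gen !upd_in => -[] e1.
  by move: jj; rewrite e1 eqxx.
have -> : upd v (j :: a) = mcat (mgen j) (upd v a).
  rewrite mcat_gen upd_in; apply/ffunP => i'; have [<-|ii] := eqVneq i i'.
    by rewrite !upd_in.
  by rewrite !upd_out.
rewrite left_adj_vec IH (linear_bigsum (left_op_bounded _).1) -[LHS]addr0 -addrA; congr (_ + _).
have -> : 1%N :: iota 2 (size a) = map (addn 1) (iota 0 (size a).+1) by rewrite -iotaDl.
rewrite big_map addrC; apply/eqP; rewrite eq_sym subr_eq0; apply/eqP.
apply: eq_bigr => t _; rewrite -left_op_mcat /=; congr L.
apply/ffunP => i'; rewrite mcat_gen; have [<-|ii] := eqVneq i i'.
  by rewrite !upd_in.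
by rewrite !(upd_out _ _ ii).
Qed.

(** The multiwords w which are empty outside l and for which S_w^* does not
    kill vec v. *)
Definition prefixes (v : mword) (l : seq 'I_k) : seq mword :=
  foldr (fun i s => [seq upd w (take t (v i)) | w <- s, t <- iota 0 (size (v i)).+1])
    [:: mnil] l.

Lemma prefixes_cons v i l : prefixes v (i :: l) =
  [seq upd w (take t (v i)) | w <- prefixes v l, t <- iota 0 (size (v i)).+1].
Proof. by []. Qed.

Lemma prefixes_nil v l w i : w \in prefixes v l -> i \notin l -> w i = [::].
Proof.
elim: l w => [|i' l IH] w; first by rewrite inE => /eqP -> _; rewrite mnilE.
rewrite prefixes_cons; case/allpairsPdep => w' [t [w'l _ ->]]; rewrite in_cons negb_or => /andP[ii il].
by rewrite upd_out ?IH // eq_sym.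
Qed.

Lemma prefixes_pre v l w : w \in prefixes v l -> v = mcat w (mdrop w v).
Proof.
elim: l w => [|i l IH] w.
  rewrite inE => /eqP ->; apply/ffunP => i; by rewrite mcatE mdropE mnilE drop0.
rewrite prefixes_cons; case/allpairsPdep => w' [t [/IH hw' tl ->]]; apply/ffunP => i'.
rewrite mcatE mdropE; have [<-|ii] := eqVneq i i'.
  rewrite upd_in -{1}(cat_take_drop t (v i)) size_take_min; congr (_ ++ _).
  by move: tl; rewrite mem_iota add0n ltnS => /andP[_] /minn_idPl ->.
by rewrite upd_out // -mdropE -mcatE -hw'.
Qed.

Lemma prefixes_mem v l w : v = mcat w (mdrop w v) -> (forall i, i \notin l -> w i = [::]) ->
  w \in prefixes v l.
Proof.
elim: l w => [|i l IH] w hv hl.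
  by rewrite inE; apply/eqP/ffunP => i; rewrite hl // mnilE.
rewrite prefixes_cons; apply/allpairsPdep; exists (upd w ([::] : seq 'I_(n i))), (size (w i)); split.
- apply: IH.
    apply/ffunP => i'; rewrite mcatE mdropE; have [<-|ii] := eqVneq i i'.
      by rewrite upd_in drop0.
    by rewrite upd_out // {1}hv mcatE mdropE.
  move=> i' il; have [<-|ii] := eqVneq i i'; first by rewrite upd_in.
  by rewrite upd_out // hl // in_cons negb_or il eq_sym ii.
- by rewrite mem_iota /= add0n ltnS hv mcatE size_cat leq_addr.
- apply/ffunP => i'; have [<-|ii] := eqVneq i i'; last by rewrite !upd_out.
  by rewrite upd_in hv mcatE take_size_cat.
Qed.

Lemma prefixes_uniq v l : uniq l -> uniq (prefixes v l).
Proof.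
elim: l => // i l IH; rewrite cons_uniq => /andP[il /IH ul]; rewrite prefixes_cons; apply: allpairs_uniq => //; first exact: iota_uniq.
move=> p p' /allpairsPdep [u [s [ul' sl ->]]] /allpairsPdep [u' [s' [ul'' sl' ->]]] h.
rewrite /uncurry in h.
have e1 : u = u'.
  apply/ffunP => i'; have [<-|ii] := eqVneq i i'.
    by rewrite (prefixes_nil ul' il) (prefixes_nil ul'' il).
  by have := congr1 (fun x : mword => x i') h; rewrite /= !upd_out.
congr (_, _) => //.
have := congr1 (fun x : mword => size (x i)) h; rewrite /= !upd_in !size_take_min.
by move: sl sl'; rewrite !mem_iota; lia.
Qed.

(** On basis vectors, Y is the sum over w of S_w Delta(Y) S_w^*, where only
    the finitely many prefixes w of v contribute. The indices are added one by
    one to l. *)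
Lemma telescope (Y : T -> T) l v : bounded_op Y -> uniq l ->
  Y (vec v) = \sum_(w <- prefixes v l) L w (partial_defect l Y (vec (mdrop w v))).
Proof.
move=> bY; elim: l => [_|i l IH]; last rewrite cons_uniq => /andP[il ul].
  rewrite /= big_seq1 left_op_nil; congr (Y (vec _)).
  by apply/ffunP => i; rewrite mdropE mnilE drop0.
rewrite IH // prefixes_cons big_allpairs_dep big_seq [RHS]big_seq; apply: eq_bigr => w wl.
have wi := prefixes_nil wl il.
have hd : mdrop w v i = v i by rewrite mdropE wi drop0.
have bl := partial_defect_bounded l bY.
have := telescope_letter (lin0 bl.1) (partial_defect_cons i l Y) (v i) (mdrop w v).
rewrite -{1}hd upd_id => ->.
rewrite (linear_bigsum (left_op_bounded _).1) big_seq [RHS]big_seq; apply: eq_bigr => t.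
rewrite mem_iota add0n ltnS => /andP[_ tv].
rewrite -left_op_mcat (mcat_upd0 _ wi); congr (L _ (_ (vec _))).
apply/ffunP => i'; rewrite mdropE; have [<-|ii] := eqVneq i i'.
  by rewrite !upd_in size_takel.
by rewrite !upd_out // mdropE.
Qed.
End Model.

(** * Positive operators *)

Section PositiveOperators.
Variable R : realType.
Local Notation C := R[i].
Variable H : hilbertType R.

Lemma eq0_of_quadratic (c q : R) : 0 <= q ->
  (forall t, 0 < t -> 2 * t * c ^+ 2 <= t ^+ 2 * c ^+ 2 * q) -> c = 0.
Proof.
move=> q0 h; have q1 : 0 < q + 1 by rewrite ltr_wpDl.
(* any t > 0 with t q < 2 will do *)
have := h (q + 1)^-1; rewrite invr_gt0 q1 => /(_ isT).
set t := (q + 1)^-1 => h1.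
have t0 : 0 < t by rewrite invr_gt0.
have tq : t * q <= 1 by rewrite /t mulrC ler_pdivrMr // mul1r lerDl.
have c2 : 0 <= c ^+ 2 by rewrite sqr_ge0.
have h2 : t * c ^+ 2 * (t * q) <= t * c ^+ 2.
  by rewrite ler_piMr // mulr_ge0 // ltW.
have h3 : t * c ^+ 2 <= 0 by move: h1 h2; rewrite expr2; nra.
have h4 : c ^+ 2 <= 0 by rewrite -(pmulr_rle0 _ t0).
by apply/eqP; rewrite -sqrf_eq0 eq_le h4 c2.
Qed.

Lemma positive_op_real (A : H -> H) x :
  positive_op A -> inner (A x) x = (complex.Re (inner (A x) x))%:C.
Proof.
move=> /(_ x); case: (inner (A x) x) => a b.
by rewrite lecE /= => /andP[/eqP -> _].
Qed.

(** On a complex space, a real quadratic form comes from a self-adjoint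
    operator, by polarization. *)
Lemma positive_op_sa (A : H -> H) : linear A -> positive_op A ->
  forall x y, inner (A x) y = inner x (A y).
Proof.
move=> lA pA.
have q x : inner (A x) x = inner x (A x).
  by rewrite [RHS]innerC (positive_op_real x pA) rc_conj.
have h x y : inner (A x) y + inner (A y) x = inner x (A y) + inner y (A x).
  have := q (x + y); rewrite (linD lA) !innerDl !innerDr !q => e.
  apply: (addrI (inner x (A x))); apply: (addIr (inner y (A y))).
  by move: e; rewrite !addrA => ->.
move=> x y; have h1 := h x y; have := h ('i *: x) y.
rewrite (linZ lA) !innerZl !innerZr conjCi !mulNr -!mulrBr.
move/(mulfI (neq0Ci _)) => h2.
have : inner (A x) y *+ 2 = inner x (A y) *+ 2.
  have := congr2 (fun a b => a + b) h1 h2; rewrite /= !mulr2n.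
  by rewrite addrACA subrr addr0 [RHS]addrACA subrr addr0.
move: (inner (A x) y) (inner x (A y)) => a b e.
have two : (2%:R : C) != 0 by rewrite pnatr_eq0.
by apply: (mulIf two); rewrite !mulr_natr.
Qed.

(** With u = A z, the form at z - t |u|^2 u is - 2 t |u|^4 + O(t^2), which is
    negative for small t > 0 unless u = 0. *)
Lemma positive_op_null (A : H -> H) z : linear A -> (forall x y, inner (A x) y =
  inner x (A y)) ->
  positive_op A -> inner (A z) z = 0 -> A z = 0.
Proof.
move=> lA sA pA hz; apply/rnorm0_eq.
pose u := A z; set c := rnorm u.
pose q := complex.Re (inner (A u) u).
have eq0 : inner (A u) u = q%:C by exact: positive_op_real.
have q0 : 0 <= q by have := pA u; rewrite eq0 lecR.
suff : c ^+ 2 = 0 by move/eqP; rewrite sqrf_eq0 => /eqP.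
apply: (eq0_of_quadratic q0) => t t0.
have := pA (z - (t * c ^+ 2)%:C *: u).
rewrite (linB lA) (linZ lA) innerBl !innerBr !innerZl !innerZr hz !rc_conj.
have -> : inner (A z) u = (c ^+ 2)%:C by rewrite -/u innerxx.
have -> : inner (A u) z = (c ^+ 2)%:C by rewrite sA -/u innerxx.
rewrite eq0 sub0r -!rcM -rcB -[- _](sub0r) -[0]/(0%:C : C) -!rcB lecR.
by move: (c ^+ 2) => d; lra.
Qed.

Lemma Re_le_rnorm (z : C) : `|complex.Re z| <= rnorm z.
Proof. by have := normc_ge_Re z; rewrite rnormE lecR. Qed.

(** The quadratic form of a bounded operator is continuous. *)
Lemma form_ge0_dense (E : H -> H) (A : set H) : bounded_op E -> closure A = setT ->
  (forall p, A p -> 0 <= complex.Re (inner (E p) p)) ->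
  forall x, 0 <= complex.Re (inner (E x) x).
Proof.
move=> bE tA h x; have [K K0 hK] := bounded_opP bE.1 bE.2.
rewrite -oppr_le0; apply: le0_of_le_eps => eps eps0.
have c0 : 0 <= K * (2 * rnorm x + 1) by rewrite mulr_ge0 ?ltW // ltr_wpDl // mulr_ge0 ?rnorm_ge0.
have B0 : 0 < K * (2 * rnorm x + 1) + 1 by rewrite ltr_wpDl.
pose del := Num.min 1 (eps / (K * (2 * rnorm x + 1) + 1)).
have del0 : 0 < del by rewrite lt_min ltr01 divr_gt0.
have [p hp xp] : exists2 p, A p & rnorm (x - p) <= del.
  have /closure_rnormP : closure A x by rewrite tA.
  exact.
have hd : rnorm (inner (E x) x - inner (E p) p) <= eps.
  have -> : inner (E x) x - inner (E p) p = inner (E (x - p)) x + inner (E p) (x - p).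
    by rewrite (linB bE.1) innerBl innerBr addrA subrK.
  have h1 : rnorm (inner (E (x - p)) x) <= K * rnorm (x - p) * rnorm x.
    by apply: (le_trans (cauchy_schwarz _ _)); apply: ler_wpM2r; rewrite ?rnorm_ge0 ?hK.
  have h2 : rnorm (inner (E p) (x - p)) <= K * rnorm p * rnorm (x - p).
    by apply: (le_trans (cauchy_schwarz _ _)); apply: ler_wpM2r; rewrite ?rnorm_ge0 ?hK.
  have h3 : rnorm p <= rnorm x + 1.
    have := rnormD (p - x) x; rewrite subrK rnormBC => h3; apply: (le_trans h3).
    by rewrite addrC; apply: lerD => //; apply: (le_trans xp); rewrite ge_min lexx.
  have d0 := rnorm_ge0 (x - p).
  apply: (le_trans (rnormD _ _)); apply: (le_trans (lerD h1 h2)).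
  have -> : K * rnorm (x - p) * rnorm x + K * rnorm p * rnorm (x - p) = K * (rnorm x + rnorm p) * rnorm (x - p) by ring.
  apply: (@le_trans _ _ ((K * (2 * rnorm x + 1) + 1) * del)).
    apply: ler_pM => //; first by rewrite mulr_ge0 ?addr_ge0 ?rnorm_ge0 // ltW.
    apply: (@le_trans _ _ (K * (2 * rnorm x + 1))); last by rewrite lerDl.
    by apply: ler_wpM2l; [exact: ltW|lra].
  by rewrite mulrC -ler_pdivlMr // ge_min lexx orbT.
apply: le_trans hd.
rewrite -[X in X <= _]addr0; apply: (@le_trans _ _ (- complex.Re (inner (E x) x) + complex.Re (inner (E p) p))).
  by apply: lerD => //; exact: h.
apply: le_trans (Re_le_rnorm _); rewrite raddfB /= -opprB normrN; apply: le_trans (ler_norm _).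
by rewrite addrC.
Qed.
End PositiveOperators.

(** * Invariant subspaces with positive defect *)

Section Defect.
Variables (R : realType) (k : nat) (n : 'I_k -> nat).
Variables (H : 'I_k -> hilbertType R) (e : forall i, 'I_(n i) -> H i).
Variable F : forall i, fock_space (H i).
Variable T : hilbert_tensor (fun i => F i : hilbertType R).
Hypothesis e_basis : forall i, orthonormal_basis setT (@e i) setT.
Local Notation C := R[i].
Local Notation mword := {dffun forall i : 'I_k, seq 'I_(n i)}.
Local Notation vec := (vec e T).
Local Notation L := (@left_op R k n H e F T).
Local Notation Ls := (@left_adj R k n H e F T).
Local Notation mnil := (@mnil k n).
Let vq := vec_orthonormal T e_basis.
Let vt := vec_total T e_basis.
Let Lb := left_op_bounded T e_basis.
Let Lsb := left_adj_bounded T e_basis.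

Variables (M : set T) (hM : closed_subspace M) (SM : S_invariant e M).
Let P := orth_proj M.
Let D := defect e M.
Hypothesis posD : positive_op D.

Lemma defect_bounded : bounded_op D.
Proof. exact: (partial_defect_bounded e_basis _ (orth_proj_bounded hM)). Qed.
Let lD := defect_bounded.1.

Lemma defect_sa x y : inner (D x) y = inner x (D y).
Proof. by apply: (partial_defect_sa e_basis) => u v; exact: orth_proj_sa. Qed.

Lemma defect_in x : M (D x).
Proof. by apply: (partial_defect_in e_basis _ hM SM) => u; exact: orth_proj_in. Qed.

Lemma left_op_in w x : M x -> M (L w x).
Proof.
elim/mword_ind: w x => [x Mx|i j w IH x Mx]; first by rewrite left_op_nil.
by rewrite left_op_mcat // -opS_L //; apply: SM; exact: IH.
Qed.

(** The quadratic form of S_w Delta S_w^*. These forms are nonnegative when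
    Delta is, and over all w they add up to the form |P x|^2 of the projection
    onto M. *)
Definition defect_form (w : mword) (x : T) : R := complex.Re (inner (D (Ls w x)) (Ls w x)).
Lemma defect_formE w x : inner (D (Ls w x)) (Ls w x) = (defect_form w x)%:C.
Proof. exact: positive_op_real. Qed.
Lemma defect_form_ge0 w x : 0 <= defect_form w x.
Proof. by have := posD (Ls w x); rewrite defect_formE lecR. Qed.

(** The part of the series P = sum of S_w Delta S_w^* with w in W. *)
Definition truncation (W : seq mword) (x : T) : T := \sum_(w <- W) L w (D (Ls w x)).

Lemma truncation_bounded W : bounded_op (truncation W).
Proof.
apply: sum_bounded => w; exact: (comp_bounded (Lb w) (comp_bounded defect_bounded (Lsb w))).
Qed.

Lemma truncation_sa W x y : inner (truncation W x) y = inner x (truncation W y).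
Proof.
rewrite inner_suml inner_sumr; apply: eq_bigr => w _.
by rewrite left_op_adjoint // defect_sa left_adj_adjoint.
Qed.

Lemma truncation_form W x : inner (truncation W x) x = (\sum_(w <- W) defect_form w x)%:C.
Proof.
rewrite inner_suml rc_sum; apply: eq_bigr => w _.
by rewrite left_op_adjoint // defect_formE.
Qed.

(** W only has to contain the prefixes of the words which occur in p. *)
Lemma truncation_poly (p : T) : lspan (range vec) p ->
  exists2 s : seq mword, uniq s & forall W, uniq W -> {subset s <= W} -> truncation W p = P p.
Proof.
move=> [t [ht ->]]; elim: t ht => [|[a x] t IH] ht.
  exists [::] => // W uW _; rewrite big_nil (lin0 (truncation_bounded W).1) /P.
  by rewrite (lin0 (orth_proj_bounded hM).1).
have [|s us hs] := IH; first by move=> q qt; apply: ht; rewrite in_cons qt orbT.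
have [v _ /= hv] := ht (a, x) (mem_head _ _).
exists (undup (prefixes v (enum 'I_k) ++ s)); first exact: undup_uniq.
move=> W uW sW; rewrite big_cons /= (linD (truncation_bounded W).1) (linZ (truncation_bounded W).1).
rewrite hs //; last by move=> w ws; apply: sW; rewrite mem_undup mem_cat ws orbT.
have lP := (orth_proj_bounded hM).1.
rewrite /P (linD lP) (linZ lP); congr (_ *: _ + _).
rewrite -{x ht}hv (telescope e_basis v (orth_proj_bounded hM) (enum_uniq 'I_k)) /truncation.
rewrite (bigID (mem (prefixes v (enum 'I_k)))) /= [X in _ + X]big1 ?addr0; last first.
  move=> w wp; rewrite (left_adj_vec0 T e_basis) ?(lin0 lD) ?left_op0 //.
  by apply: contra wp => /eqP h; apply: prefixes_mem => // i; rewrite mem_enum.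
rewrite -big_filter; apply: etrans (perm_big (prefixes v (enum 'I_k)) _) _.
  apply: uniq_perm; [exact: filter_uniq|exact: prefixes_uniq (enum_uniq _)|move=> w].
  rewrite mem_filter /=; apply: andb_idr => wp; apply: sW.
  by rewrite mem_undup mem_cat wp.
rewrite big_seq [RHS]big_seq; apply: eq_bigr => w wp; congr (L _ (D _)).
by rewrite {1}(prefixes_pre wp) left_adj_vec.
Qed.

Lemma defect_form_sum_sub W W' x : uniq W -> uniq W' -> {subset W <= W'} ->
  \sum_(w <- W) defect_form w x <= \sum_(w <- W') defect_form w x.
Proof.
move=> uW uW' s; rewrite [leRHS](bigID (mem W)) /= -[leLHS]addr0; apply: lerD; last first.
  by apply: sumr_ge0 => w _; exact: defect_form_ge0.
rewrite -[leRHS]big_filter le_eqVlt; apply/orP; left; apply/eqP; apply: perm_big; apply: uniq_perm => //; first exact: filter_uniq.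
by move=> w; rewrite mem_filter /=; apply/esym/andb_idr; exact: s.
Qed.

Lemma truncation_gap W x : inner (P x - truncation W x) x =
  (rnorm (P x) ^+ 2 - \sum_(w <- W) defect_form w x)%:C.
Proof.
rewrite innerBl truncation_form rcB; congr (_ - _).
by rewrite -innerxx /P [RHS]orth_proj_sa // (orth_proj_id hM (orth_proj_in x hM)) orth_proj_sa.
Qed.

(** If p is a polynomial, the sum over W is part of a sum of nonnegative terms
    over a larger set, whose value is |P p|^2. Polynomials are dense. *)
Lemma defect_form_sum_le W x : uniq W -> \sum_(w <- W) defect_form w x <= rnorm (P x) ^+ 2.
Proof.
move=> uW.
have bE := sub_bounded (orth_proj_bounded hM) (truncation_bounded W).
have := form_ge0_dense bE vt _ x; rewrite -/P truncation_gap => h.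
suff : 0 <= rnorm (P x) ^+ 2 - \sum_(w <- W) defect_form w x by rewrite subr_ge0.
apply: h => p hp; rewrite -/P truncation_gap /=.
have [s us hs] := truncation_poly hp; rewrite subr_ge0.
have h := hs (undup (W ++ s)) (undup_uniq _).
have {}h : truncation (undup (W ++ s)) p = P p.
  by apply: h => w ws; rewrite mem_undup mem_cat ws orbT.
have := truncation_gap (undup (W ++ s)) p; rewrite h subrr inner0l => -[] /esym /eqP.
rewrite subr_eq0 => /eqP ->; apply: defect_form_sum_sub => //; first exact: undup_uniq.
by move=> w ws; rewrite mem_undup mem_cat ws.
Qed.

Lemma truncation_gap_pos W : uniq W -> positive_op (fun x => P x - truncation W x).
Proof. by move=> uW x; rewrite truncation_gap lecR subr_ge0; exact: defect_form_sum_le. Qed.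

(** P - truncation W lies between 0 and P, and it kills a polynomial p near x
    if W is large enough. Then its form at x equals its form at x - p, which
    is at most |x - p|^2. *)
Lemma defect_form_sum_approx x (eps : R) : 0 < eps -> exists2 s : seq mword, uniq s &
  forall W, uniq W -> {subset s <= W} -> rnorm (P x) ^+ 2 - \sum_(w <- W) defect_form w x <= eps.
Proof.
move=> eps0.
have del0 : 0 < Num.min 1 eps by rewrite lt_min ltr01.
have [p hp xp] : exists2 p, lspan (range vec) p & rnorm (x - p) <= Num.min 1 eps.
  have /closure_rnormP : closure (lspan (range vec)) x by rewrite vt.
  exact.
have [s us hs] := truncation_poly hp; exists s => // W uW sW.
have bE := sub_bounded (orth_proj_bounded hM) (truncation_bounded W).
have e1 : inner (P x - truncation W x) x = inner (P (x - p) - truncation W (x - p)) (x - p).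
  have Ep : P p - truncation W p = 0 by rewrite hs // subrr.
  have -> : P (x - p) - truncation W (x - p) = P x - truncation W x.
    by rewrite (linB bE.1) -/P Ep subr0.
  rewrite innerBr; suff -> : inner (P x - truncation W x) p = 0 by rewrite subr0.
  have -> : inner (P x - truncation W x) p = inner x (P p - truncation W p).
    by rewrite innerBl innerBr truncation_sa orth_proj_sa.
  by rewrite Ep inner0r.
have := truncation_gap W x; rewrite e1 truncation_gap => -[] <-.
apply: (@le_trans _ _ (rnorm (x - p) ^+ 2)).
  rewrite lerBlDr; apply: (@le_trans _ _ (rnorm (x - p) ^+ 2)).
    by rewrite ler_pXn2r ?nnegrE ?rnorm_ge0 // orth_proj_le.
  by rewrite lerDl; apply: sumr_ge0 => w _; exact: defect_form_ge0.
have h1 : rnorm (x - p) <= 1 by apply: (le_trans xp); rewrite ge_min lexx.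
have h2 : rnorm (x - p) <= eps by apply: (le_trans xp); rewrite ge_min lexx orbT.
by rewrite expr2; apply: le_trans h2; rewrite ler_piMr ?rnorm_ge0.
Qed.

(** Let g be the generator. The forms at S_g y add up to |S_g y|^2 = |y|^2,
    and those of the multiwords g w already add up to |y|^2, being the forms
    of the multiwords w at y. Hence the form of the empty multiword vanishes
    at S_g y. *)
Lemma defect_left_gen i (j : 'I_(n i)) y : M y -> D (L (mgen j) y) = 0.
Proof.
move=> My; apply: (positive_op_null lD defect_sa posD).
have := defect_formE mnil (L (mgen j) y); rewrite !left_adj_nil // => ->.
suff : defect_form mnil (L (mgen j) y) <= 0.
  by move=> h; congr (_%:C); apply/eqP; rewrite eq_le h defect_form_ge0.
apply: le0_of_le_eps => eps eps0.
have [s us hs] := defect_form_sum_approx y eps0.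
have {}hs := hs s us (fun _ => id).
(* the empty multiword together with the multiwords g w, w in s *)
have uW : uniq (mnil :: map (mcat (mgen j)) s).
  rewrite /= map_inj_uniq ?us ?andbT; last exact: mcatI.
  by apply/mapP => -[w _ h]; have := mcat_gen_neq0 j w; rewrite -h eqxx.
have := defect_form_sum_le (L (mgen j) y) uW.
rewrite big_cons big_map /P !orth_proj_id //; last exact: left_op_in.
rewrite (left_op_rnorm e_basis) => h.
have e1 : \sum_(w <- s) defect_form (mcat (mgen j) w) (L (mgen j) y) = \sum_(w <- s) defect_form w y.
  by apply: eq_bigr => w _; rewrite /defect_form left_adj_mcat // left_adjK.
rewrite e1 in h; rewrite /P orth_proj_id // in hs; lra.
Qed.

Lemma defect_left_op w y : M y -> w != mnil -> D (L w y) = 0.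
Proof.
move=> My; elim/mword_ind: w => [|i j w _ _]; first by rewrite eqxx.
by rewrite left_op_mcat //; apply: defect_left_gen; exact: left_op_in.
Qed.

Lemma defect_left_adj_defect w y : w != mnil -> D (Ls w (D y)) = 0.
Proof.
move=> wn; apply: (basis_eq vt) => v; rewrite inner0l.
by rewrite defect_sa left_adj_adjoint // defect_sa defect_left_op ?inner0r //; exact: defect_in.
Qed.

(** At z = Delta y all forms of nonempty multiwords vanish, so that |z|^2 =
    <Delta z, z>. Thus the form of the positive operator P - Delta vanishes at
    z, and Delta z = P z = z. In particular Delta is an orthogonal projection. *)
Lemma wandering_idem y : D (D y) = D y.
Proof.
set z := D y.
have Mz : M z by exact: defect_in.
have Pz : P z = z by rewrite /P orth_proj_id.
have rqz w : w != mnil -> defect_form w z = 0 by move=> wn; rewrite /defect_form defect_left_adj_defect // inner0l.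
have := truncation_gap_pos (W := [:: mnil]) isT.
have bE := sub_bounded (orth_proj_bounded hM) (truncation_bounded [:: mnil]).
have sE : forall x y, inner (P x - truncation [:: mnil] x) y = inner x (P y - truncation [:: mnil] y).
  by move=> u v; rewrite innerBl innerBr truncation_sa orth_proj_sa.
move=> pE; have := positive_op_null bE.1 sE pE (z := z).
have fd := truncation_gap [:: mnil] z; rewrite /P in fd; rewrite fd -/P Pz => h.
suff : z - truncation [:: mnil] z = 0.
  by move/eqP; rewrite subr_eq0 /truncation big_seq1 left_op_nil // left_adj_nil // => /eqP <-.
apply: h; congr (_%:C); apply/eqP; rewrite eq_le; apply/andP; split; last first.
  by rewrite subr_ge0 -{2}Pz; exact: defect_form_sum_le.
apply: le0_of_le_eps => eps eps0.
have [s us hs] := defect_form_sum_approx z eps0.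
have := hs (undup (mnil :: s)) (undup_uniq _); rewrite Pz => {}hs.
apply: le_trans (hs _); last by move=> w ws; rewrite mem_undup in_cons ws orbT.
rewrite big_seq1; apply: lerD => //; rewrite lerN2.
rewrite (bigD1_seq mnil) ?undup_uniq ?mem_undup ?mem_head //= big1 ?addr0 //.
Qed.

(** The forms at x add up to |P x|^2 = |x|^2. *)
Lemma defect_separates x : M x -> (forall w, D (Ls w x) = 0) -> x = 0.
Proof.
move=> Mx h; apply/rnorm0_eq/eqP; rewrite -sqrf_eq0 eq_le exprn_ge0 ?rnorm_ge0 // andbT.
apply: le0_of_le_eps => eps eps0.
have [s us hs] := defect_form_sum_approx x eps0.
have := hs s us (fun _ => id); rewrite /P orth_proj_id // big1 ?subr0 // => w _.
by rewrite /defect_form h inner0l.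
Qed.

(** The forms at S_v psi add up to |psi|^2, which is already the value of the
    form of v. The form of w vanishes therefore, that is Delta S_w^* S_v psi =
    0. *)
Lemma wandering_orthogonal v w psi psi' : D psi = psi -> D psi' = psi' -> v != w ->
  inner (L v psi) (L w psi') = 0.
Proof.
move=> h h' vw.
have Mpsi : M psi by rewrite -h; exact: defect_in.
have uW : uniq [:: v; w] by rewrite /= inE vw.
have := defect_form_sum_le (L v psi) uW.
rewrite big_cons big_seq1 /P orth_proj_id //; last exact: left_op_in.
rewrite (left_op_rnorm e_basis).
have -> : defect_form v (L v psi) = rnorm psi ^+ 2 by rewrite /defect_form left_adjK // h innerxx.
rewrite gerDl => r0.
have z0 : D (Ls w (L v psi)) = 0.
  apply: (positive_op_null lD defect_sa posD); rewrite defect_formE; congr (_%:C).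
  by apply/eqP; rewrite eq_le r0 defect_form_ge0.
by rewrite -h' -left_adj_adjoint // -defect_sa z0 inner0l.
Qed.
End Defect.

(** * Right multipliers *)

Section Multipliers.
Variables (R : realType) (k : nat) (n : 'I_k -> nat).
Variables (H : 'I_k -> hilbertType R) (e : forall i, 'I_(n i) -> H i).
Variable F : forall i, fock_space (H i).
Variable T : hilbert_tensor (fun i => F i : hilbertType R).
Hypothesis e_basis : forall i, orthonormal_basis setT (@e i) setT.
Local Notation C := R[i].
Local Notation mword := {dffun forall i : 'I_k, seq 'I_(n i)}.
Local Notation vec := (vec e T).
Local Notation L := (@left_op R k n H e F T).
Local Notation Ls := (@left_adj R k n H e F T).
Local Notation mnil := (@mnil k n).
Let vq := vec_orthonormal T e_basis.
Let vt := vec_total T e_basis.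
Let Lb := left_op_bounded T e_basis.
Let Lsb := left_adj_bounded T e_basis.

Lemma fourier_dist (s : seq mword) (x : T) : uniq s ->
  rnorm (x - \sum_(w <- s) inner x (vec w) *: vec w) ^+ 2 =
  rnorm x ^+ 2 - \sum_(w <- s) rnorm (inner x (vec w)) ^+ 2.
Proof.
move=> us; set y := \sum_(w <- s) _.
have ny : rnorm y ^+ 2 = \sum_(w <- s) rnorm (inner x (vec w)) ^+ 2.
  by rewrite (qon_finite_norm _ vq us); apply: eq_bigr => w _; rewrite mulr1.
have o : inner (x - y) y = 0.
  rewrite {2}/y inner_sumr big_seq big1 // => w ws.
  rewrite innerZr innerBl /y inner_suml (bigD1_seq w) //= big1 ?addr0 => [|v vw].
    by rewrite innerZl (vq w w) eqxx mulr1 subrr mulr0.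
  by rewrite innerZl (vq v w) (negbTE vw) mulr0.
by rewrite -ny -{2}(subrK y x) (pythagoras o) addrK.
Qed.

#[local] Existing Instance summability.totally_filter.

(** Unconditional convergence: adding terms to a partial Fourier sum only
    decreases its distance to x. *)
Lemma fourier_totally (x : T) :
  summability.partial_sum (fun w : mword => inner x (vec w) *: vec w) @ summability.totally --> x.
Proof.
apply/cvgrPdist_le => eps eps0.
have e1 := gt0_real eps0.
have e0 : 0 < complex.Re eps by rewrite -ltcR -e1.
have /cvg_rnormP/(_ _ e0) [N /(_ N (leqnn N))] := @qon_total _ _ _ _ (enum_family_qon vq) (enum_family_total vt) x.
pose s0 := pmap (@pickle_inv (mword : countType)) (iota 0 N).
have us0 : uniq s0 by exact: pmap_pickle_uniq.
have -> : \sum_(0 <= i < N) inner x (enum_family vec i) *: enum_family vec i =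
    \sum_(w <- s0) inner x (vec w) *: vec w.
  rewrite (sum_enum_family vec (fun i => inner x (enum_family vec i)) N).
  by apply: eq_bigr => w _; rewrite enum_family_pickle.
move=> hN.
exists [fset w in s0]%fset => // A /= sA.
rewrite /summability.partial_sum rnormE e1 lecR -(big_seq_fsetE _ _ predT (fun w => inner x (vec w) *: vec w)) /=.
apply: le_trans hN; rewrite -(@ler_pXn2r _ 2) ?nnegrE ?rnorm_ge0 //.
rewrite (fourier_dist x (fset_uniq A)) (fourier_dist x us0).
rewrite lerD2l lerN2 [leRHS](bigID (mem s0)) /= -[leLHS]addr0; apply: lerD; last first.
  by apply: sumr_ge0 => w _; rewrite exprn_ge0 // rnorm_ge0.
rewrite -[leRHS]big_filter le_eqVlt; apply/orP; left; apply/eqP; apply: perm_big.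
apply: uniq_perm => //; first exact: filter_uniq (fset_uniq A).
move=> w; rewrite mem_filter /=; apply/esym/andb_idr => ws.
by apply: (fsubsetP sA); rewrite inE.
Qed.

(** The polynomial with the coefficients and the multiwords of t, in the
    operators S instead of the basis vectors. *)
Definition left_poly (t : seq (C * mword)) (x : T) : T := \sum_(q <- t) q.1 *: L q.2 x.

Lemma left_poly_bounded t : bounded_op (left_poly t).
Proof. by apply: sum_bounded => q; exact: (scale_bounded _ (Lb _)). Qed.

Lemma polynomial_repP (p : T) : is_polynomial e p ->
  exists t : seq (C * mword), p = \sum_(q <- t) q.1 *: vec q.2.
Proof.
case=> s [hs ->]; elim: s hs => [|[a x] s IH] hs.
  by exists [::]; rewrite !big_nil.
have [|t ht] := IH; first by move=> q qs; apply: hs; rewrite in_cons qs orbT.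
have [v _ /= hv] := hs (a, x) (mem_head _ _).
by exists ((a, v) :: t); rewrite !big_cons ht /= hv.
Qed.

Lemma polynomial_of_rep (t : seq (C * mword)) : is_polynomial e (\sum_(q <- t) q.1 *: vec q.2).
Proof.
elim: t => [|q t IH]; first by exists [::]; rewrite !big_nil.
by rewrite big_cons; apply: lspanZD => //; apply: lspan_in; exists q.2.
Qed.

(** Since R_{w~} e_v = e_{vw} = S_v e_w, applying the series of the multiplier
    phi to e_v amounts to applying S_v to the Fourier series of phi. *)
Lemma mult_polyE (phi : T) (t : seq (C * mword)) :
  mult_poly e phi (\sum_(q <- t) q.1 *: vec q.2) = left_poly t phi.
Proof.
rewrite /mult_poly /summability.sum; apply: cvg_lim; first exact: norm_hausdorff.
have bB := left_poly_bounded t; have [lB cB] := bB.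
have -> : (fun w : mword => inner phi (vec w) *: opR_rev e w (\sum_(q <- t) q.1 *: vec q.2)) =
    (fun w : mword => inner phi (vec w) *: left_poly t (vec w)).
  apply/funext => w; congr (_ *: _).
  have [bR hR] := opR_revP T e_basis w.
  rewrite (linear_bigsum bR.1); apply: eq_bigr => q _.
  by rewrite (linZ bR.1) hR left_op_vec.
have -> : summability.partial_sum (fun w : mword => inner phi (vec w) *: left_poly t (vec w)) =
   left_poly t \o summability.partial_sum (fun w : mword => inner phi (vec w) *: vec w).
  apply/funext => A; rewrite /= /summability.partial_sum (linear_bigsum lB).
  by apply: eq_bigr => w _; rewrite (linZ lB).
have [K K0 hK] := bounded_opP lB cB.
have := @fourier_totally phi => /cvgrPdist_le h.
apply/cvgrPdist_le => eps eps0.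
have e1 := gt0_real eps0.
have e0 : 0 < complex.Re eps by rewrite -ltcR -e1.
have /h [A _ hA] : 0 < (complex.Re eps / K)%:C by rewrite ltcR divr_gt0.
exists A => // B /hA /=; rewrite !rnormE lecR -(linB lB) => h1.
rewrite e1 lecR; by apply: (le_trans (hK _)); rewrite mulrC -ler_pdivlMr.
Qed.

(** The multiplier bound concerns polynomials of norm at most 1; by
    homogeneity it bounds e_v |-> S_v phi on their span, which extends to the
    whole space. *)
Lemma mult_opP (phi : T) : right_multiplier e phi ->
  bounded_op (mult_op e phi) /\
  forall p, is_polynomial e p -> mult_op e phi p = mult_poly e phi p.
Proof.
move=> [c hc].
suff [A [bA hA]] : exists A : T -> T, bounded_op A /\ forall v : mword, A (vec v) = L v phi.
  apply: bounded_op_such_thatP; exists A; split=> // p /polynomial_repP [t ->].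
  rewrite mult_polyE (linear_bigsum bA.1); apply: eq_bigr => q _.
  by rewrite (linZ bA.1) hA.
apply: (extend_along_basis (K := `|complex.Re c|) vq vt) => // s d us.
pose t : seq (C * mword) := [seq (d w, w) | w <- s].
have ev : \sum_(i <- s) d i *: vec i = \sum_(q <- t) q.1 *: vec q.2 by rewrite big_map.
have eL : \sum_(i <- s) d i *: L i phi = left_poly t phi by rewrite /left_poly big_map.
rewrite ev eL -mult_polyE; set p := \sum_(q <- t) _.
(* a vanishing polynomial cannot be normalized, but it also has the empty
   representation *)
have [p0|p0] := eqVneq p 0.
  have h0 : mult_poly e phi p = 0.
    by rewrite p0; have := mult_polyE phi [::]; rewrite /left_poly !big_nil.
  by rewrite h0 rnorm0 mulr_ge0 ?rnorm_ge0.
have hp : 0 < rnorm p by rewrite lt_neqAle rnorm_ge0 andbT eq_sym; apply: contraNneq p0 => /rnorm0_eq ->.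
pose t' : seq (C * mword) := [seq (((rnorm p)^-1)%:C * q.1, q.2) | q <- t].
have et' : \sum_(q <- t') q.1 *: vec q.2 = ((rnorm p)^-1)%:C *: p.
  by rewrite /p scaler_sumr big_map; apply: eq_bigr => q _; rewrite scalerA.
have Lt' : left_poly t' phi = ((rnorm p)^-1)%:C *: left_poly t phi.
  by rewrite /left_poly scaler_sumr big_map; apply: eq_bigr => q _; rewrite scalerA.
have := hc _ (polynomial_of_rep t').
rewrite et' rnormE rnormZ rnorm_realC ger0_norm ?invr_ge0 ?rnorm_ge0 // mulVf ?gt_eqF // => /(_ (lexx _)).
rewrite -et' mult_polyE Lt' rnormE rnormZ rnorm_realC ger0_norm ?invr_ge0 ?rnorm_ge0 //.
rewrite /p mult_polyE -/p lecE /= => /andP[_ h].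
have {}h : (rnorm p)^-1 * rnorm (left_poly t phi) <= `|complex.Re c| by apply: (le_trans h); exact: ler_norm.
by move: h; rewrite mulrC ler_pdivrMr.
Qed.

Lemma mult_op_vec (phi : T) (v : mword) : right_multiplier e phi ->
  mult_op e phi (vec v) = L v phi.
Proof.
move=> /mult_opP [_ h]; have := mult_polyE phi [:: (1, v)].
rewrite /left_poly !big_seq1 !scale1r => <-; apply: h.
by apply: lspan_in; exists v.
Qed.

Lemma mult_op_nil (phi : T) : right_multiplier e phi -> mult_op e phi (vec mnil) = phi.
Proof. by move=> h; rewrite mult_op_vec // left_op_nil. Qed.

(** Left and right multiplications commute. *)
Lemma mult_op_comm (phi : T) w x : right_multiplier e phi ->
  mult_op e phi (L w x) = L w (mult_op e phi x).
Proof.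
move=> h; have [b _] := mult_opP h.
have hh : mult_op e phi \o L w = L w \o mult_op e phi.
  apply: (op_eq_basis vt); [exact: (comp_bounded b (Lb _))|exact: (comp_bounded (Lb _) b)|].
  by move=> v; rewrite /= left_op_vec // !mult_op_vec // left_op_mcat.
exact: (congr1 (fun f => f x) hh).
Qed.

Lemma mult_op_adj (phi : T) x y : right_multiplier e phi ->
  inner (mult_op e phi x) y = inner x (adjoint (mult_op e phi) y).
Proof. by move=> /mult_opP [b _]; exact: (op_adj_basis vq vt b). Qed.

Lemma adj_mult_op (phi : T) x y : right_multiplier e phi ->
  inner (adjoint (mult_op e phi) x) y = inner x (mult_op e phi y).
Proof. by move=> h; rewrite innerC -mult_op_adj // -innerC. Qed.

Lemma mult_adj_bounded (phi : T) : right_multiplier e phi ->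
  bounded_op (adjoint (mult_op e phi)).
Proof.
move=> h; have [b _] := mult_opP h.
by apply: (adjoint_bounded b) => x y; exact: mult_op_adj.
Qed.

(** The multiplier maps the orthonormal basis e_v to the vectors S_v phi. *)
Lemma isometric_multiplier (phi : T) :
  (forall v w : mword, inner (L v phi) (L w phi) = (v == w)%:R) ->
  right_multiplier e phi /\ isometric (mult_op e phi).
Proof.
move=> hphi.
have hq : quasi_orthonormal predT (fun v : mword => L v phi) by move=> v w; rewrite hphi andbT.
have [A [bA hA]] := extend_contraction vq vt hq.
have iA : forall x, rnorm (A x) = rnorm x.
  by apply: (isometric_on_basis vq vt bA) => v w; rewrite !hA hphi.
have rm : right_multiplier e phi.
  exists 1 => p /polynomial_repP [t ->].
  have eA : A (\sum_(q <- t) q.1 *: vec q.2) = left_poly t phi.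
    by rewrite (linear_bigsum bA.1); apply: eq_bigr => q _; rewrite (linZ bA.1) hA.
  by rewrite mult_polyE -eA (rnormE (A _)) iA -rnormE.
split=> // x; have [b _] := mult_opP rm; rewrite !rnormE; congr (_%:C).
rewrite (_ : mult_op e phi = A) ?iA //.
by apply: (op_eq_basis vt b bA) => v; rewrite hA mult_op_vec.
Qed.
End Multipliers.

(** * Beurling factorizations *)

Section Beurling.
Variables (R : realType) (k : nat) (n : 'I_k -> nat).
Variables (H : 'I_k -> hilbertType R) (e : forall i, 'I_(n i) -> H i).
Variable F : forall i, fock_space (H i).
Variable T : hilbert_tensor (fun i => F i : hilbertType R).
Hypothesis e_basis : forall i, orthonormal_basis setT (@e i) setT.
Local Notation C := R[i].
Local Notation mword := {dffun forall i : 'I_k, seq 'I_(n i)}.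
Local Notation vec := (vec e T).
Local Notation L := (@left_op R k n H e F T).
Local Notation Ls := (@left_adj R k n H e F T).
Local Notation mnil := (@mnil k n).
Let vq := vec_orthonormal T e_basis.
Let vt := vec_total T e_basis.
Let Lb := left_op_bounded T e_basis.
Let Lsb := left_adj_bounded T e_basis.

Lemma sums_toE (V : normedModType C) N (v : nat -> V) x : sums_to N v x <->
  (fun m => \sum_(0 <= s < m) if lt_len s N then v s else 0) @ \oo --> x.
Proof.
rewrite /sums_to (_ : (fun m => _) = (fun m => \sum_(0 <= s < m) if lt_len s N then v s else 0)) //.
by apply/funext => m; rewrite big_mkcond.
Qed.

Lemma sums_to1 (V : normedModType C) N (v : nat -> V) s : lt_len s N ->
  (forall t, lt_len t N -> t != s -> v t = 0) -> sums_to N v (v s).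
Proof.
move=> hs h; apply/sums_toE/cvg_rnormP => eps eps0; exists s.+1 => m sm.
rewrite (bigD1_seq s) /=; [|by rewrite mem_index_iota|by rewrite iota_uniq].
rewrite hs big1 ?addr0 ?subrr ?rnorm0 ?ltW // => t ts; case: ifP => // ht; exact: h.
Qed.

Lemma sums_to_uniq (V : normedModType C) N (v : nat -> V) x y :
  sums_to N v x -> sums_to N v y -> x = y.
Proof. exact: cvg_nat_unique. Qed.

Lemma sums_to_op (G K : hilbertType R) (A : G -> K) N (v : nat -> G) x : bounded_op A ->
  sums_to N v x -> sums_to N (fun s => A (v s)) (A x).
Proof.
move=> bA h; have := op_cvg bA h; rewrite /sums_to.
rewrite (_ : A \o _ = (fun m => \sum_(0 <= s < m | lt_len s N) A (v s))) //.
by apply/funext => m; rewrite /= (linear_bigsum bA.1).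
Qed.

Lemma sums_to_inner (G : hilbertType R) N (v : nat -> G) x y :
  sums_to N v x -> sums_to (V := C^o) N (fun s => inner (v s) y) (inner x y).
Proof.
move=> h; have := inner_cvgl (y := y) h; rewrite /sums_to.
rewrite (_ : (fun m => inner _ _) = (fun m => \sum_(0 <= s < m | lt_len s N) inner (v s) y)) //.
by apply/funext => m; rewrite /= inner_suml.
Qed.

Arguments sums_to_inner {G N v x} y _.

Lemma eq_sums_to (V : normedModType C) N (v w : nat -> V) x :
  (forall s, lt_len s N -> v s = w s) -> sums_to N v x -> sums_to N w x.
Proof.
move=> h; rewrite /sums_to (_ : (fun m => \sum_(0 <= s < m | lt_len s N) v s) =
  (fun m => \sum_(0 <= s < m | lt_len s N) w s)) //.
by apply/funext => m; apply: eq_bigr => s; exact: h.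
Qed.

Lemma sums_to_in (G : hilbertType R) (V : set G) N (v : nat -> G) x : closed_subspace V ->
  (forall s, lt_len s N -> V (v s)) -> sums_to N v x -> V x.
Proof. by move=> hV h; apply: subspace_cvg => // m; apply: subspace_sum => // s _; exact: h. Qed.

Variables (M : set T) (hM : closed_subspace M).
Local Notation P := (orth_proj M).
Local Notation D := (defect e M).
Local Notation op := (mult_op e).
Let bD : bounded_op D := defect_bounded e_basis hM.
Let lD := bD.1.

Section FromPositivity.
Hypothesis SM : S_invariant e M.
Hypothesis posD : positive_op D.

Lemma subspace_fixed : closed_subspace [set x | D x = x].
Proof.
rewrite (_ : [set x | _] = [set x | D x - x = 0]).
  exact: (subspace_ker (sub_bounded bD (@id_bounded R T))).
apply/seteqP; split=> x /=; first by move=> ->; rewrite subrr.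
by move/eqP; rewrite subr_eq0 => /eqP.
Qed.

(** The sequence psi is an orthonormal basis of the range of the projection
    Delta. The vectors S_w psi_s are then orthonormal, which yields isometries
    with orthogonal ranges in M. A vector x of M orthogonal to all these
    ranges satisfies Delta S_w^* x = 0 for all w, hence x = 0. *)
Lemma beurling_exists : exists N psi, beurling_sequence e M N psi /\
  forall s, lt_len s N -> range D (psi s).
Proof.
have [|y /= yD hy|N [psi [psiD psi1 psit]]] :=
    @onb_exists _ _ [set x | D x = x] (fun i => D (enum_family vec i)) subspace_fixed.
- by move=> i /=; exact: wandering_idem.
- apply: (total_orth0 (enum_family_total vt)) => _ [i _ <-]; apply: inner_eq0C.
  by rewrite -yD (defect_sa e_basis hM).
have wand s t v w : lt_len s N -> lt_len t N ->
    inner (L v (psi s)) (L w (psi t)) = ((v == w) && (s == t))%:R.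
  move=> hs ht; have [<-|vw] := eqVneq v w.
    by rewrite left_op_inner // psi1.
  by rewrite (wandering_orthogonal e_basis hM SM posD _ _ vw) //; exact: psiD.
have im s : lt_len s N -> right_multiplier e (psi s) /\ isometric (op (psi s)).
  by move=> hs; apply: isometric_multiplier => // v w; rewrite wand // eqxx andbT.
have rm s : lt_len s N -> right_multiplier e (psi s) by move=> /im [].
have opL s : lt_len s N -> bounded_op (op (psi s)) by move=> /rm/(mult_opP e_basis) [].
have iso s x y : lt_len s N -> inner (op (psi s) x) (op (psi s) y) = inner x y.
  move=> hs; apply: isometric_inner; last by have [] := im s hs.
  by have [] := opL s hs.
have orth s t : lt_len s N -> lt_len t N -> s != t ->
    forall x y, inner (op (psi s) x) (op (psi t) y) = 0.
  move=> hs ht st x y.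
  have z : adjoint (op (psi t)) \o op (psi s) = fun=> 0.
    apply: (op_eq_basis vt); [|exact: zero_bounded|].
      exact: (comp_bounded (mult_adj_bounded e_basis (rm _ ht)) (opL s hs)).
    move=> v /=; apply: (basis_eq vt) => w; rewrite inner0l (adj_mult_op e_basis _ _ (rm t ht)).
    by rewrite (mult_op_vec e_basis v (rm s hs)) (mult_op_vec e_basis w (rm t ht)) wand // (negbTE st) andbF.
  have zx : adjoint (op (psi t)) (op (psi s) x) = 0 := congr1 (fun f => f x) z.
  by rewrite -(adj_mult_op e_basis _ _ (rm t ht)) zx inner0l.
exists N, psi; split; last by move=> s hs; exists (psi s) => //; exact: psiD.
split=> //; first by move=> s /im [].
move=> x.
pose y s := op (psi s) (adjoint (op (psi s)) x).
(* the Fourier series of x along the directions of the y s is their sum, which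
   therefore converges *)
pose f s := if lt_len s N then normalize (y s) else 0.
have xy s : lt_len s N -> inner x (y s) = (rnorm (y s) ^+ 2)%:C.
  move=> hs; rewrite /y -(adj_mult_op e_basis _ _ (rm s hs)) -(iso s _ _ hs).
  exact: innerxx.
have fE s : lt_len s N -> f s = normalize (y s) by move=> hs; rewrite /f hs.
have f0 s : lt_len s N = false -> f s = 0 by move=> hs; rewrite /f hs.
have fq : quasi_orthonormal (fun s => f s != 0) f.
  move=> s t; case hs : (lt_len s N); last by rewrite (f0 s hs) inner0l eqxx andbF.
  have [<-|st] /= := eqVneq s t.
    by rewrite fE // innerxx rnorm_normalize; case: eqP.
  case ht : (lt_len t N); last by rewrite (f0 t ht) inner0r.
  by rewrite !fE // /normalize innerZl innerZr /y orth // !mulr0.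
have fy s : inner x (f s) *: f s = if lt_len s N then y s else 0.
  case hs : (lt_len s N); last by rewrite (f0 s hs) scaler0.
  rewrite fE // /normalize innerZr rc_conj xy // scalerA -!rcM.
  have [v0|v0] := eqVneq (rnorm (y s)) 0; first by rewrite v0 invr0 mulr0 scale0r (rnorm0_eq v0).
  by rewrite expr2 mulrA mulVf // mul1r mulfV // scale1r.
have [z hz] := qon_cvg x fq.
have hz' : sums_to N y z.
  apply/sums_toE; rewrite (_ : (fun m => _) = (fun m => \sum_(0 <= i < m) inner x (f i) *: f i)) //.
  by apply/funext => m; apply: eq_bigr => s _; rewrite fy.
have yM s : lt_len s N -> M (y s).
  move=> hs; rewrite /y; move: (adjoint _ x) => u; move: u.
  have pc := subspace_preim (opL s hs) hM.
  apply: (total_ind vt pc) => _ [v _ <-]; rewrite /preimage /= (mult_op_vec e_basis v (rm s hs)).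
  by apply: left_op_in => //; rewrite -(psiD s hs); exact: defect_in.
have Mz : M z by exact: (sums_to_in hM yM hz').
suff -> : P x = z by [].
apply/eqP; rewrite -subr_eq0; apply/eqP.
apply: (defect_separates e_basis hM posD); first by apply: subspaceB => //; exact: orth_proj_in.
move=> w; apply: psit => [|s hs]; first exact: wandering_idem.
have Mw : M (L w (psi s)) by apply: left_op_in => //; rewrite -(psiD s hs); exact: defect_in.
rewrite (defect_sa e_basis hM) (psiD s hs) left_adj_adjoint // innerBl orth_proj_sa // (orth_proj_id hM Mw).
have := sums_to_inner (L w (psi s)) hz'.
have := @sums_to1 C^o N (fun t => inner (y t) (L w (psi s))) s hs.
move=> h1 h2; rewrite (sums_to_uniq h2 (h1 _)).
  by rewrite -(mult_op_vec e_basis _ (rm s hs)) iso // (adj_mult_op e_basis _ _ (rm s hs)) subrr.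
by move=> t ht ts; rewrite -(mult_op_vec e_basis _ (rm s hs)) orth.
Qed.
End FromPositivity.

Section FromSequence.
Variables (N : option nat) (psi : nat -> T).
Hypothesis hpsi : beurling_sequence e M N psi.

Let rm s : lt_len s N -> right_multiplier e (psi s). Proof. by case: hpsi => h _ _ _; exact: h. Qed.
Let ob s : lt_len s N -> bounded_op (op (psi s)).
Proof. by move=> /rm /(mult_opP e_basis) []. Qed.
Let iso s x y : lt_len s N -> inner (op (psi s) x) (op (psi s) y) = inner x y.
Proof. by move=> hs; have [_ h _ _] := hpsi; apply: isometric_inner; [exact: (ob hs).1|exact: h]. Qed.
Let orth s t x y : lt_len s N -> lt_len t N -> s != t -> inner (op (psi s) x) (op (psi t) y) = 0.
Proof. by move=> hs ht st; have [_ _ h _] := hpsi; exact: h. Qed.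

Lemma psi_orthonormal s t : lt_len s N -> lt_len t N -> inner (psi s) (psi t) = (s == t)%:R.
Proof.
move=> hs ht; rewrite -(mult_op_nil e_basis (rm hs)) -(mult_op_nil e_basis (rm ht)).
have [<-|st] := eqVneq s t; last exact: orth.
by rewrite iso // vq eqxx.
Qed.

Lemma adj_iso s x : lt_len s N -> adjoint (op (psi s)) (op (psi s) x) = x.
Proof.
move=> hs; apply: (basis_eq vt) => v.
by rewrite (adj_mult_op e_basis _ _ (rm hs)) iso.
Qed.

Lemma adj_orth s t x : lt_len s N -> lt_len t N -> s != t ->
  adjoint (op (psi s)) (op (psi t) x) = 0.
Proof.
move=> hs ht st; apply: (basis_eq vt) => v.
by rewrite (adj_mult_op e_basis _ _ (rm hs)) orth ?inner0l // eq_sym.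
Qed.

(** The projection onto M fixes the range of each isometry because of the
    orthogonality of the ranges. *)
Lemma op_range_in s x : lt_len s N -> M (op (psi s) x).
Proof.
move=> hs; have [_ _ _ h] := hpsi.
have h2 := h (op (psi s) x).
have h1 : sums_to N (fun t => op (psi t) (adjoint (op (psi t)) (op (psi s) x)))
    (op (psi s) (adjoint (op (psi s)) (op (psi s) x))).
  apply: (@sums_to1 T N (fun t => op (psi t) (adjoint (op (psi t)) (op (psi s) x))) s hs) => t ht ts.
  by rewrite adj_orth // (lin0 (ob ht).1).
have := sums_to_uniq h1 h2; rewrite adj_iso // => ->; exact: orth_proj_in.
Qed.

(** M is the closed sum of the ranges of operators which commute with S. *)
Lemma beurling_invariant : S_invariant e M.
Proof.
move=> i j x Mx; have [_ _ _ h] := hpsi; have := h x; rewrite (orth_proj_id hM Mx) => hx.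
rewrite opS_L //; apply: (sums_to_in hM _ (sums_to_op (Lb _) hx)) => s hs.
by rewrite -(mult_op_comm e_basis _ _ (rm hs)); exact: op_range_in.
Qed.

(** The multipliers A_s commute with S, so that the defect of A_s A_s^* is A_s
    Delta(I) A_s^*, where Delta(I) is the projection onto the vacuum vector
    and A_s maps that vector to psi_s. The defect map is linear and continuous
    for pointwise convergence. *)
Lemma defect_sum xi : sums_to N (fun s => inner xi (psi s) *: psi s) (D xi).
Proof.
have [_ _ _ h] := hpsi.
pose Y s : T -> T := if lt_len s N then fun x => op (psi s) (id (adjoint (op (psi s)) x)) else fun=> 0.
have hY x : (fun m => \sum_(0 <= s < m) Y s x) @ \oo --> P x.
  rewrite (_ : (fun m => _) = (fun m => \sum_(0 <= s < m)
    if lt_len s N then op (psi s) (adjoint (op (psi s)) x) else 0)).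
    exact: (proj1 (sums_toE _ _ _) (h x)).
  by apply/funext => m; apply: eq_bigr => s _; rewrite /Y; case: ifP.
have := partial_defect_cvg (l := enum 'I_k) e_basis hY (x := xi); rewrite -defectE => hD.
apply/sums_toE; rewrite (_ : (fun m => _) =
  (fun m => partial_defect e (enum 'I_k) (fun x => \sum_(0 <= s < m) Y s x) xi)) //.
apply/funext => m; rewrite (partial_defect_sum e_basis); apply: eq_bigr => s _.
rewrite /Y; case: ifP => hs; last first.
  clear hD; elim: (enum 'I_k) xi => // i l IH xi; rewrite partial_defect_cons // -IH big1 ?subr0 // => j _.
  by rewrite -IH left_op0.
rewrite (partial_defect_comm e_basis (enum 'I_k) id (ob hs).1).
- rewrite (defect_id e_basis) (linZ (ob hs).1) (mult_op_nil e_basis (rm hs)).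
  congr (_ *: _).
  by rewrite (adj_mult_op e_basis _ _ (rm hs)) (mult_op_nil e_basis (rm hs)).
- by move=> w x; rewrite (mult_op_comm e_basis _ _ (rm hs)).
- move=> w x; apply: (basis_eq vt) => v.
  rewrite (adj_mult_op e_basis _ _ (rm hs)) left_adj_adjoint // -(mult_op_comm e_basis _ _ (rm hs)).
  by rewrite left_adj_adjoint // (adj_mult_op e_basis _ _ (rm hs)).
Qed.
Arguments defect_sum xi : clear implicits.

Lemma defect_psi s : lt_len s N -> D (psi s) = psi s.
Proof.
move=> hs.
have h1 : sums_to N (fun t => inner (psi s) (psi t) *: psi t) (inner (psi s) (psi s) *: psi s).
  apply: (@sums_to1 T N (fun t => inner (psi s) (psi t) *: psi t) s hs) => t ht ts.
  by rewrite psi_orthonormal // eq_sym (negbTE ts) scale0r.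
have := sums_to_uniq (defect_sum (psi s)) h1.
by rewrite psi_orthonormal // eqxx scale1r.
Qed.

Lemma defect_idem x : D (D x) = D x.
Proof.
have h1 := sums_to_op bD (defect_sum x).
apply: (sums_to_uniq h1 _).
apply: (eq_sums_to _ (defect_sum x)) => s hs.
by rewrite (linZ lD) defect_psi.
Qed.

Lemma defect_positive : positive_op D.
Proof.
move=> x; rewrite -defect_idem (defect_sa e_basis hM) innerxx lecR.
by rewrite exprn_ge0 // rnorm_ge0.
Qed.

Lemma fixed_expand x : D x = x -> sums_to N (fun s => inner x (psi s) *: psi s) x.
Proof. by move=> h; have := defect_sum x; rewrite h. Qed.

Lemma closure_psi : closure (lspan (psi @` [set s | lt_len s N])) = [set x | D x = x].
Proof.
apply/seteqP; split.
  by apply: closure_lspan_min; [exact: subspace_fixed|move=> _ [s hs <-]; exact: defect_psi].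
move=> x /= Dx; have cs := subspace_closure_lspan (psi @` [set s | lt_len s N]).
apply: (sums_to_in cs _ (fixed_expand Dx)) => s hs.
have hp : closure (lspan (psi @` [set s | lt_len s N])) (psi s).
  by apply: subset_closure; apply: lspan_in; exists s.
exact: (subspaceZ _ cs hp).
Qed.

(** Any positive root B of the projection Delta has the same range: Delta B =
    B because |B x|^2 = <Delta x, x> vanishes for x in the kernel of Delta,
    and Delta = B B. *)
Lemma rank_sqrt : has_rank (sqrt_op D) N.
Proof.
have [bB [pB BB]] : bounded_op (sqrt_op D) /\ (positive_op (sqrt_op D) /\ sqrt_op D \o sqrt_op D = D).
  apply: bounded_op_such_thatP; exists D; split=> //; split; first exact: defect_positive.
  by apply/funext => x /=; exact: defect_idem.
set B := sqrt_op D in bB pB BB *.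
have BBx x : B (B x) = D x by rewrite -BB.
have sB := positive_op_sa bB.1 pB.
have BD x : B (D x) = D (B x) by rewrite -!BBx.
have DB x : D (B x) = B x.
  rewrite -BD; apply/esym/eqP; rewrite -subr_eq0 -(linB bB.1); apply/eqP/inner_self0.
  by rewrite -sB BBx (linB lD) defect_idem subrr inner0l.
have eR : closure (range B) = [set x | D x = x].
  have -> : range B = [set x | D x = x].
    apply/seteqP; split=> [_ [x _ <-] //|x /= Dx].
    by exists (B x) => //; rewrite BBx.
  by apply/esym/closure_id; have [] := subspace_fixed.
exists psi; rewrite /orthonormal_basis eR closure_psi; split=> //.
exact: psi_orthonormal.
Qed.
End FromSequence.

(** Double counting of the squared numbers |<psi'_s, psi_t>|: for fixed s they
    add up to 1, for fixed t to at most 1. *)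
Lemma beurling_length_le m psi N' psi' a : beurling_sequence e M (Some m) psi ->
  beurling_sequence e M N' psi' -> (forall s, (s < a)%N -> lt_len s N') -> (a <= m)%N.
Proof.
move=> h h' ha.
have q := pad_qon (psi_orthonormal h); have q' := pad_qon (psi_orthonormal h').
rewrite -(ler_nat R).
have -> : (a%:R : R) = \sum_(0 <= s < a) \sum_(0 <= t < m) rnorm (inner (psi' s) (psi t)) ^+ 2.
  rewrite -{1}[a]subn0 -sumr_const_nat big_nat [RHS]big_nat; apply: eq_bigr => s /andP[_ /ha hs].
  have := fixed_expand h (defect_psi h' hs) => hx.
  have ex : psi' s = \sum_(0 <= t < m) inner (psi' s) (psi t) *: pad (Some m) psi t.
    apply: (cvg_nat_unique hx); apply/cvg_rnormP => eps eps0; exists m => p mp.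
    rewrite (@big_cat_nat _ _ _ m 0 p) //= [X in _ - (_ + X)]big_nat_cond [X in _ - (_ + X)]big1 ?addr0.
      have -> : \sum_(0 <= i < m | (i < m)%N) inner (psi' s) (psi i) *: psi i =
          \sum_(0 <= t < m) inner (psi' s) (psi t) *: pad (Some m) psi t.
        rewrite big_mkcond; apply: eq_bigr => t _.
        by rewrite /pad /=; case: ifP; rewrite ?scaler0.
      by rewrite subrr rnorm0 ltW.
    by move=> t /andP[/andP[mt _]]; rewrite /= ltnNge mt.
  have := qon_norm (fun t => inner (psi' s) (psi t)) 0 m q; rewrite -ex => e1.
  have := psi_orthonormal h' hs hs; rewrite eqxx innerxx => -[]; rewrite e1 => <-.
  by rewrite big_nat [RHS]big_nat; apply: eq_bigr => t /andP[_ /= ->]; rewrite mulr1.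
rewrite exchange_big /= -{2}[m]subn0 -sumr_const_nat big_nat [leRHS]big_nat.
apply: ler_sum => t /andP[_ tm].
have := bessel (psi t) a q'; rewrite (_ : rnorm (psi t) ^+ 2 = 1); last first.
  by have := psi_orthonormal h (tm : lt_len t (Some m)) tm; rewrite eqxx innerxx => -[].
apply: le_trans; rewrite big_nat [leRHS]big_nat; apply: ler_sum => s /andP[_ /ha hs].
by rewrite /pad hs innerC rnormC.
Qed.

Lemma beurling_length N psi N' psi' : beurling_sequence e M N psi ->
  beurling_sequence e M N' psi' -> N = N'.
Proof.
move=> h h'; case: N h => [m|] h; case: N' h' => [m'|] h' //.
- congr Some; apply/eqP; rewrite eqn_leq.
  by rewrite (beurling_length_le h' h (a := m)) // (beurling_length_le h h' (a := m')).
- by have := beurling_length_le h h' (a := m.+1) (fun _ _ => isT); rewrite ltnn.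
- by have := beurling_length_le h' h (a := m'.+1) (fun _ _ => isT); rewrite ltnn.
Qed.

(** Both sequences are orthonormal bases of the range of the same projection
    Delta; the entries <psi'_s, psi_t> of the change of basis form a unitary
    matrix by Parseval's identity. *)
Lemma beurling_unique N psi N' psi' : beurling_sequence e M N psi ->
  beurling_sequence e M N' psi' -> unitarily_equivalent_seq N psi N' psi'.
Proof.
move=> h h'; have NN := beurling_length h h'; split=> //; move: h'; rewrite -{N'}NN => h'.
exists (fun s t => inner (psi' s) (psi t)); last first.
  by move=> s hs; exact: (fixed_expand h (defect_psi h' hs)).
split=> s t hs ht.
  have := sums_to_inner (psi' t) (fixed_expand h (defect_psi h' hs)).
  rewrite (psi_orthonormal h') //; apply: eq_sums_to => r hr.
  by rewrite innerZl -innerC.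
have := sums_to_inner (psi s) (fixed_expand h' (defect_psi h ht)).
rewrite (psi_orthonormal h ht hs) [in (t == s)]eq_sym; apply: eq_sums_to => r hr.
by rewrite innerZl mulrC -innerC.
Qed.
End Beurling.

Theorem theorem2p2 (R : realType) (k : nat) (n : 'I_k -> nat)
    (H : 'I_k -> hilbertType R) (e : forall i, 'I_(n i) -> H i)
    (F : forall i, fock_space (H i))
    (T : hilbert_tensor (fun i => F i : hilbertType R))
    (k_ge1 : (1 <= k)%N) (n_ge1 : forall i, (1 <= n i)%N)
    (e_basis : forall i, orthonormal_basis setT (e i) setT)
    (M : set T) (M_subspace : closed_subspace M) :
  [/\ (S_invariant e M /\ positive_op (defect e M) <->
        (exists N psi, beurling_sequence e M N psi)),
      forall N psi N' psi',
        beurling_sequence e M N psi -> beurling_sequence e M N' psi' ->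
        unitarily_equivalent_seq N psi N' psi',
      S_invariant e M /\ positive_op (defect e M) ->
        exists N psi, beurling_sequence e M N psi /\
          forall s, lt_len s N -> range (defect e M) (psi s)
    & forall N psi, beurling_sequence e M N psi ->
        has_rank (sqrt_op (defect e M)) N /\
        forall xi, sums_to N (fun s => inner xi (psi s) *: psi s) (defect e M xi)].
Proof.
split.
- split=> [[SM pD]|[N [psi h]]].
    by have [N [psi [h _]]] := beurling_exists e_basis M_subspace SM pD; exists N, psi.
  by split; [exact: (beurling_invariant e_basis M_subspace h)|exact: (defect_positive e_basis M_subspace h)].
- by move=> N psi N' psi'; exact: beurling_unique.
- by move=> [SM pD]; exact: beurling_exists.
- by move=> N psi h; split; [exact: rank_sqrt h|exact: defect_sum h].
Qed.
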